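(* Let $(\Omega,\Sigma,\mu)$ be a complete finite measure space, let $(\mathcal H,L)$ be a measurable bundle of complex Hilbert spaces over $\Omega$, let $d\ge1$, and let $T_1,T_2,\dots,T_d$ be contractions in $L^0(\Omega,\mathcal H)$. Then for any $\hat u\in L^0(\Omega,\mathcal H)$ the multiparameter ergodic average $$A_{n_1,n_2,\dots,n_d}(T_1,T_2,\dots,T_d,\hat u)=\frac1{n_1n_2\cdots n_d}\sum_{i_1=0}^{n_1-1}\sum_{i_2=0}^{n_2-1}\cdots\sum_{i_d=0}^{n_d-1}T_1^{i_1}T_2^{i_2}\cdots T_d^{i_d}(\hat u)$$ is norm convergent as $n_1,n_2,\dots,n_d\to\infty$ independently.
   Context: $L^0=L^0(\Omega)$ is the algebra of a.e.-equivalence classes of complex measurable functions on $\Omega$; order relations between real elements of $L^0$ are a.e., and $\mathbf 1\in L^0$ is the class of the constant function $1$. Measurable bundle of Hilbert spaces: $\mathcal H$ assigns to each $\omega\in\Omega$ a complex Hilbert space $\mathcal H(\omega)$. A section is a function $u$ defined a.e. on $\Omega$, with domain $\mathrm{dom}(u)$, such that $u(\omega)\in\mathcal H(\omega)$ for $\omega\in\mathrm{dom}(u)$. For a set $L$ of sections, $(\mathcal H,L)$ is a measurable bundle if (1) $\lambda_1c_1+\lambda_2c_2\in L$ for all $\lambda_1,\lambda_2\in\mathbb C$, $c_1,c_2\in L$, where this section is defined pointwise on $\mathrm{dom}(c_1)\cap\mathrm{dom}(c_2)$; (2) $\omega\mapsto\|c(\omega)\|_{\mathcal H(\omega)}$ is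 measurable for all $c\in L$; (3) for every $\omega\in\Omega$ the set $\{c(\omega):c\in L,\ \omega\in\mathrm{dom}(c)\}$ is dense in $\mathcal H(\omega)$. A step-section is $s(\omega)=\sum_{i=1}^n\chi_{A_i}(\omega)c_i(\omega)$ with $c_i\in L$, $A_i\in\Sigma$. A section $u$ is measurable if there are step-sections $s_n$ with $\|s_n(\omega)-u(\omega)\|_{\mathcal H(\omega)}\to0$ for almost all $\omega$. $M(\Omega,\mathcal H)$ is the set of measurable sections, and $L^0(\Omega,\mathcal H)$ is its quotient by a.e. equality; $\hat u$ is the class of $u$. $L^0(\Omega,\mathcal H)$ is an $L^0$-module under pointwise operations, with $L^0$-valued norm $\|\hat u\|$ = the class of $\omega\mapsto\|u(\omega)\|_{\mathcal H(\omega)}$; with the pointwise inner product it is a Hilbert–Kaplansky space over $L^0$ (and every Hilbert–Kaplansky space over $L^0$ is isometrically isomorphic to one of this form). An operator $T:L^0(\Omega,\mathcal H)\to L^0(\Omega,\mathcal H)$ is $L^0$-linear if $T(\alpha x+\beta y)=\alpha T(x)+\beta T(y)$ for all $\alpha,\beta\in L^0$ and all $x,y$; an $L^0$-linear $T$ is $L^0$-bounded if it maps bounded sets (sets $B$ with $\{\|x\|:x\in B\}$ order bounded in $L^0$) to bounded sets. Its norm is $\|T\|=\sup\{\|Tx\|:\|x\|\le\mathbf 1\}\in L^0$. A contraction in $L^0(\Omega,\mathcal H)$ is an $L^0$-linear, $L^0$-bounded operator with $\|T\|\le\mathbf 1$. Norm convergence means $(bo)$-convergence with respect to the $L^0$-valued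 norm: a net $x_\alpha$ converges to $x$ if there is a decreasing net $(e_\gamma)$ in $L^0$ with $\inf_\gamma e_\gamma=0$ such that for each $\gamma$ there is $\alpha(\gamma)$ with $\|x-x_\alpha\|\le e_\gamma$ for all $\alpha\ge\alpha(\gamma)$. Here the averages form a net indexed by $(n_1,\dots,n_d)\in\mathbb N^d$ with the coordinatewise order. The operators $T_1,\dots,T_d$ are not assumed to commute. *)

(* Defs.v *)
From HB Require Import structures.
From mathcomp Require Import all_boot all_order all_algebra.
From mathcomp Require Import complex generic_quotient finmap lra.
From mathcomp Require Import all_classical all_reals all_analysis.
From mathcomp Require Import measurable_realfun.

Set Implicit Arguments.
Unset Strict Implicit.
Unset Printing Implicit Defensive.

Import Order.TTheory GRing.Theory Num.Theory ComplexField.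
Import numFieldTopology.Exports numFieldNormedType.Exports HBSimple.

Local Open Scope classical_set_scope.
Local Open Scope ring_scope.
Local Open Scope quotient_scope.

(* A complex Hilbert space is a complete normed space over [R[i]] whose norm
   comes from an inner product, linear in its first argument. *)
HB.mixin Record isHilbert (R : realType) (V : Type)
    of CompleteNormedModule R[i] V := {
  inner : V -> V -> R[i] ;
  inner_linear : forall (a : R[i]) (u v w : V),
    inner (a *: u + v) w = a * inner u w + inner v w ;
  inner_conj : forall u v : V, inner v u = Num.conj (inner u v) ;
  inner_norm : forall u : V, inner u u = `|u| ^+ 2
}.

#[short(type="hilbertType")]
HB.structure Definition Hilbert (R : realType) :=
  {V of isHilbert R V & CompleteNormedModule R[i] V}.

Section L0.
Context {d : measure_display} {T : measurableType d} {R : realType}.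

Definition cmeasurable (f : T -> R[i]) :=
  measurable_fun setT (fun w => complex.Re (f w)) /\
  measurable_fun setT (fun w => complex.Im (f w)).

Record cmfun := CMFun {
  cmfun_fun :> T -> R[i] ;
  cmfun_measurable : cmeasurable cmfun_fun }.

HB.instance Definition _ := gen_eqMixin cmfun.
HB.instance Definition _ := gen_choiceMixin cmfun.

Lemma cmeasurable_cst c : cmeasurable (fun _ => c).
Proof. by split; exact: measurable_cst. Qed.

Lemma cmeasurableD (f g : T -> R[i]) : cmeasurable f -> cmeasurable g ->
  cmeasurable (fun w => f w + g w).
Proof.
move=> [fr fi] [gr gi]; split.
- apply: (eq_measurable_fun (fun w => complex.Re (f w) + complex.Re (g w))).
    by move=> w _; rewrite raddfD.
  exact: measurable_funD.
- apply: (eq_measurable_fun (fun w => complex.Im (f w) + complex.Im (g w))).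
    by move=> w _; rewrite raddfD.
  exact: measurable_funD.
Qed.

Lemma cmeasurableM (f g : T -> R[i]) : cmeasurable f -> cmeasurable g ->
  cmeasurable (fun w => f w * g w).
Proof.
move=> [fr fi] [gr gi]; split.
- apply: (eq_measurable_fun (fun w => complex.Re (f w) * complex.Re (g w)
    - complex.Im (f w) * complex.Im (g w))).
    by move=> w _; case: (f w) => a b; case: (g w).
  by apply: measurable_funB; exact: measurable_funM.
- apply: (eq_measurable_fun (fun w => complex.Re (f w) * complex.Im (g w)
    + complex.Im (f w) * complex.Re (g w))).
    by move=> w _; case: (f w) => a b; case: (g w).
  by apply: measurable_funD; exact: measurable_funM.
Qed.

Definition cmfun_cst c := CMFun (cmeasurable_cst c).
Definition cmfun_add (f g : cmfun) :=
  CMFun (cmeasurableD (cmfun_measurable f) (cmfun_measurable g)).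
Definition cmfun_mul (f g : cmfun) :=
  CMFun (cmeasurableM (cmfun_measurable f) (cmfun_measurable g)).

Variable mu : {finite_measure set T -> \bar R}.

Definition cmfun_ae_eq (f g : cmfun) : bool := `[< f = g %[ae mu] >].

Let cmfun_ae_eq_refl : reflexive cmfun_ae_eq.
Proof. by move=> f; apply/asboolP/aeW. Qed.

Let cmfun_ae_eq_sym : symmetric cmfun_ae_eq.
Proof.
by move=> f g; apply/idP/idP => /asboolP h; apply/asboolP; apply: ae_eq_sym.
Qed.

Let cmfun_ae_eq_trans : transitive cmfun_ae_eq.
Proof.
by move=> f g h /asboolP gf /asboolP fh; apply/asboolP/(ae_eq_trans gf fh).
Qed.

Canonical cmfun_ae_eq_canonical := EquivRel cmfun_ae_eq
  cmfun_ae_eq_refl cmfun_ae_eq_sym cmfun_ae_eq_trans.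

Definition L0 : Type := {eq_quot cmfun_ae_eq}.
HB.instance Definition _ := Choice.on L0.
HB.instance Definition _ := EqQuotient.on L0.

Definition L0_class (f : cmfun) : L0 := \pi_L0 f.
Definition L0_fun (x : L0) : T -> R[i] := cmfun_fun (repr x).

Lemma L0_classK (f : cmfun) : L0_fun (L0_class f) = f %[ae mu].
Proof.
suff /asboolP : cmfun_ae_eq (repr (L0_class f)) f by [].
by apply/eqmodP; rewrite reprK.
Qed.

Lemma L0_funK (x : L0) : L0_class (repr x) = x.
Proof. by rewrite /L0_class reprK. Qed.

Lemma L0_eqP (x y : L0) : x = y <-> L0_fun x = L0_fun y %[ae mu].
Proof.
split=> [->|xy]; first exact: ae_eq_refl.
rewrite -(L0_funK x) -(L0_funK y); apply/eqmodP/asboolP; exact: xy.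
Qed.

Definition L0_cst (c : R[i]) : L0 := L0_class (cmfun_cst c).
Definition L0_add (x y : L0) : L0 := L0_class (cmfun_add (repr x) (repr y)).
Definition L0_mul (x y : L0) : L0 := L0_class (cmfun_mul (repr x) (repr y)).
Definition L0_opp (x : L0) : L0 := L0_mul (L0_cst (- 1)) x.

Lemma L0_fun_cst c : L0_fun (L0_cst c) = (fun _ => c) %[ae mu].
Proof. exact: L0_classK. Qed.

Lemma L0_fun_add x y :
  L0_fun (L0_add x y) = (fun w => L0_fun x w + L0_fun y w) %[ae mu].
Proof. exact: L0_classK. Qed.

Lemma L0_fun_mul x y :
  L0_fun (L0_mul x y) = (fun w => L0_fun x w * L0_fun y w) %[ae mu].
Proof. exact: L0_classK. Qed.

Lemma L0_fun_opp x : L0_fun (L0_opp x) = (fun w => - L0_fun x w) %[ae mu].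
Proof.
have h1 := L0_fun_mul (L0_cst (-1)) x; have h2 := L0_fun_cst (-1).
by near=> w => _; rewrite (near h1 w)// (near h2 w)// mulN1r.
Unshelve. all: by end_near. Qed.

Let addA : associative L0_add.
Proof.
move=> x y z; apply/L0_eqP.
have h1 := L0_fun_add x (L0_add y z); have h2 := L0_fun_add y z.
have h3 := L0_fun_add (L0_add x y) z; have h4 := L0_fun_add x y.
by near=> w => _; rewrite (near h1 w)// (near h2 w)// (near h3 w)// (near h4 w)// addrA.
Unshelve. all: by end_near. Qed.

Let addC : commutative L0_add.
Proof.
move=> x y; apply/L0_eqP.
have h1 := L0_fun_add x y; have h2 := L0_fun_add y x.
by near=> w => _; rewrite (near h1 w)// (near h2 w)// addrC.
Unshelve. all: by end_near. Qed.

Let add0 : left_id (L0_cst 0) L0_add.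
Proof.
move=> x; apply/L0_eqP.
have h1 := L0_fun_add (L0_cst 0) x; have h2 := L0_fun_cst 0.
by near=> w => _; rewrite (near h1 w)// (near h2 w)// add0r.
Unshelve. all: by end_near. Qed.

Let addN : left_inverse (L0_cst 0) L0_opp L0_add.
Proof.
move=> x; apply/L0_eqP.
have h1 := L0_fun_add (L0_opp x) x; have h2 := L0_fun_cst 0.
have h3 := L0_fun_opp x.
by near=> w => _; rewrite (near h1 w)// (near h2 w)// (near h3 w)// addNr.
Unshelve. all: by end_near. Qed.

HB.instance Definition _ := GRing.isZmodule.Build L0 addA addC add0 addN.

Let mulA : associative L0_mul.
Proof.
move=> x y z; apply/L0_eqP.
have h1 := L0_fun_mul x (L0_mul y z); have h2 := L0_fun_mul y z.
have h3 := L0_fun_mul (L0_mul x y) z; have h4 := L0_fun_mul x y.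
by near=> w => _; rewrite (near h1 w)// (near h2 w)// (near h3 w)// (near h4 w)// mulrA.
Unshelve. all: by end_near. Qed.

Let mulC : commutative L0_mul.
Proof.
move=> x y; apply/L0_eqP.
have h1 := L0_fun_mul x y; have h2 := L0_fun_mul y x.
by near=> w => _; rewrite (near h1 w)// (near h2 w)// mulrC.
Unshelve. all: by end_near. Qed.

Let mul1 : left_id (L0_cst 1) L0_mul.
Proof.
move=> x; apply/L0_eqP.
have h1 := L0_fun_mul (L0_cst 1) x; have h2 := L0_fun_cst 1.
by near=> w => _; rewrite (near h1 w)// (near h2 w)// mul1r.
Unshelve. all: by end_near. Qed.

Let mulD : left_distributive L0_mul L0_add.
Proof.
move=> x y z; apply/L0_eqP.
have h1 := L0_fun_mul (L0_add x y) z; have h2 := L0_fun_add x y.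
have h3 := L0_fun_add (L0_mul x z) (L0_mul y z).
have h4 := L0_fun_mul x z; have h5 := L0_fun_mul y z.
by near=> w => _; rewrite (near h1 w)// (near h2 w)// (near h3 w)// (near h4 w)//
  (near h5 w)// mulrDl.
Unshelve. all: by end_near. Qed.

HB.instance Definition _ :=
  GRing.Zmodule_isComPzRing.Build L0 mulA mulC mul1 mulD.

(* On [R[i]], [a <= b] means that [b - a] is a nonnegative real, so that this
   order extends the a.e. order of real elements. *)
Definition L0_le (x y : L0) : bool :=
  `[< {ae mu, forall w, L0_fun x w <= L0_fun y w} >].

Let le_refl : reflexive L0_le.
Proof. by move=> x; apply/asboolP/aeW. Qed.

Let le_anti : antisymmetric L0_le.
Proof.
move=> x y /andP[/asboolP h1 /asboolP h2]; apply/L0_eqP.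
by near=> w => _; apply/eqP; rewrite eq_le (near h1 w)// (near h2 w).
Unshelve. all: by end_near. Qed.

Let le_trans : transitive L0_le.
Proof.
move=> y x z /asboolP h1 /asboolP h2; apply/asboolP.
by near=> w; rewrite (@le_trans _ _ (L0_fun y w))// ?(near h1 w)// (near h2 w).
Unshelve. all: by end_near. Qed.

HB.instance Definition _ :=
  Order.Le_isPOrder.Build ring_display L0 le_refl le_anti le_trans.

Lemma L0_leP (x y : L0) :
  (x <= y)%R <-> {ae mu, forall w, L0_fun x w <= L0_fun y w}.
Proof. by split=> /asboolP. Qed.

End L0.

Section Sections.
Context {T : Type} {R : realType} (H : T -> hilbertType R).

(* A section is a partial function, [None] marking points off its domain. *)
Definition psection := forall w : T, option (H w).

Definition sdom (u : psection) : set T := [set w | isSome (u w)].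

(* Value of a section, extended by [0] off its domain. *)
Definition ev (u : psection) (w : T) : H w := odflt 0 (u w).

Definition psection_comb (a : R[i]) (u : psection) (b : R[i]) (v : psection) :
    psection := fun w =>
  if isSome (u w) && isSome (v w) then Some (a *: ev u w + b *: ev v w)
  else None.

Definition step_section n (A : 'I_n -> set T) (c : 'I_n -> psection) :
    psection := fun w =>
  if [forall i, isSome (c i w)] then
    Some (\sum_(i < n) (\1_(A i) w : R[i]) *: ev (c i) w)
  else None.

End Sections.
Arguments ev {T R H} u w.

(* [measurable_fun D f] only has content when [D] is measurable; in [core_norm]
   the domain is conull, hence measurable once [mu] is complete. *)
Record measurable_bundle {d : measure_display} {T : measurableType d} {R : realType}
    (mu : {finite_measure set T -> \bar R}) := MeasurableBundle {
  fiber :> T -> hilbertType R ;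
  core : set (psection fiber) ;
  core_ae : forall c, core c -> {ae mu, forall w, sdom c w} ;
  core_comb : forall (a b : R[i]) c1 c2, core c1 -> core c2 ->
    core (psection_comb a c1 b c2) ;
  core_norm : forall c, core c ->
    measurable_fun (sdom c) (fun w => complex.Re `|ev c w|) ;
  core_dense : forall w, dense [set x | exists2 c, core c & c w = Some x] }.

Arguments core {d T R mu} H _ : rename.

Section measurable_sections.
Context {d : measure_display} {T : measurableType d} {R : realType}.
Context {mu : {finite_measure set T -> \bar R}} (H : measurable_bundle mu).

Definition is_step (s : psection H) :=
  exists n (A : 'I_n -> set T) (c : 'I_n -> psection H),
  [/\ forall i, measurable (A i), forall i, core H (c i) & s = step_section A c].

Definition measurable_section (u : psection H) :=
  {ae mu, forall w, sdom u w} /\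
  exists s : nat -> psection H, (forall n, is_step (s n)) /\
    {ae mu, forall w, ev (s n) w @[n --> \oo] --> ev u w}.

Record msection := MSection {
  msection_fun :> psection H ;
  msectionP : measurable_section msection_fun }.

HB.instance Definition _ := gen_eqMixin msection.
HB.instance Definition _ := gen_choiceMixin msection.

Definition msection_ae_eq (u v : msection) : bool :=
  `[< msection_fun u = msection_fun v %[ae mu] >].

Let msection_ae_eq_refl : reflexive msection_ae_eq.
Proof. by move=> f; apply/asboolP/aeW. Qed.

Let msection_ae_eq_sym : symmetric msection_ae_eq.
Proof.
by move=> f g; apply/idP/idP => /asboolP h; apply/asboolP;
  apply: filterS h => w h wT; rewrite h.
Qed.

Let msection_ae_eq_trans : transitive msection_ae_eq.
Proof.
move=> f g h /asboolP gf /asboolP fh; apply/asboolP.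
by apply: filterS2 gf fh => w h1 h2 wT; rewrite h1 ?h2.
Qed.

Canonical msection_ae_eq_canonical := EquivRel msection_ae_eq
  msection_ae_eq_refl msection_ae_eq_sym msection_ae_eq_trans.

Definition L0sec : Type := {eq_quot msection_ae_eq}.
HB.instance Definition _ := Choice.on L0sec.
HB.instance Definition _ := EqQuotient.on L0sec.

Definition L0sec_class (u : msection) : L0sec := \pi_L0sec u.
Definition L0sec_fun (x : L0sec) (w : T) : H w := ev (msection_fun (repr x)) w.

Lemma L0sec_classK (u : msection) :
  {ae mu, forall w, L0sec_fun (L0sec_class u) w = ev u w}.
Proof.
suff /asboolP : msection_ae_eq (repr (L0sec_class u)) u.
  by apply: filterS => w /(_ Logic.I) h; rewrite /L0sec_fun /ev h.
by apply/eqmodP; rewrite reprK.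
Qed.

Lemma L0sec_eqP (x y : L0sec) :
  x = y <-> {ae mu, forall w, L0sec_fun x w = L0sec_fun y w}.
Proof.
split=> [->|xy]; first exact: aeW.
rewrite -(reprK x) -(reprK y); apply/eqmodP/asboolP.
have [dx _] := msectionP (repr x); have [dy _] := msectionP (repr y).
move: xy dx dy; apply: filterS3 => w; rewrite /L0sec_fun /ev /sdom /=.
by case: (msection_fun _ w) => // a; case: (msection_fun _ w) => //= b -> .
Qed.

Lemma ae_ord n (P : 'I_n -> T -> Prop) : (forall i, {ae mu, forall w, P i w}) ->
  {ae mu, forall w, forall i, P i w}.
Proof.
move=> hP; have h (k : nat) : {ae mu, forall w, forall lt : (k < n)%N, P (Ordinal lt) w}.
  have [lt|nlt] := EM (k < n)%N; last by apply: aeW => w lt; case: (nlt lt).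
  by apply: filterS (hP (Ordinal lt)) => w cw lt'; rewrite (bool_irrelevance lt' lt).
by apply: filterS (ae_foralln h) => w hw [k lt]; exact: hw.
Qed.

(* Up to null sets, sections may be taken everywhere defined ([total_section]);
   [steplike] and [mtotal] are step-sections and measurability in these terms. *)
Definition steplike (v : forall w, H w) :=
  exists s, is_step s /\ {ae mu, forall w, ev s w = v w}.

Lemma steplike_ae v v' : {ae mu, forall w, v w = v' w} ->
  steplike v -> steplike v'.
Proof.
move=> vv' [s [ss sv]]; exists s; split => //.
by apply: filterS2 vv' sv => w -> ->.
Qed.

Lemma step_sectionE n (A : 'I_n -> set T) (c : 'I_n -> psection H) :
  (forall i, core H (c i)) -> {ae mu, forall w, ev (step_section A c) w =
    \sum_(i < n) (\1_(A i) w : R[i]) *: ev (c i) w}.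
Proof.
move=> cc; have := ae_ord (fun i => core_ae (cc i)).
apply: filterS => w cw; rewrite /step_section /ev.
by case: ifPn => // /forallP; case=> i; exact: cw.
Qed.

Lemma is_step_ae s : is_step s -> {ae mu, forall w, sdom s w}.
Proof.
move=> [n [A [c [mA cc ->]]]].
apply: filterS (ae_ord (fun i => core_ae (cc i))) => w hw.
rewrite /sdom /= /step_section.
by case: ifPn => // /forallP; case=> i; exact: hw.
Qed.

Lemma steplike_sum n (A : 'I_n -> set T) (c : 'I_n -> psection H) :
  (forall i, measurable (A i)) -> (forall i, core H (c i)) ->
  steplike (fun w => \sum_(i < n) (\1_(A i) w : R[i]) *: ev (c i) w).
Proof.
move=> mA cc; exists (step_section A c); split; last exact: step_sectionE.
by exists n, A, c.
Qed.

Lemma steplikeP v : steplike v -> exists n (A : 'I_n -> set T) (c : 'I_n -> psection H),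
  [/\ forall i, measurable (A i), forall i, core H (c i) &
   {ae mu, forall w, v w = \sum_(i < n) (\1_(A i) w : R[i]) *: ev (c i) w}].
Proof.
move=> [s [[n [A [c [mA cc ->]]]] h]]; exists n, A, c; split=> //.
by apply: filterS2 h (step_sectionE A cc) => w <- ->.
Qed.

Lemma ev_comb (a : R[i]) (c1 : psection H) (b : R[i]) (c2 : psection H) : core H c1 -> core H c2 ->
  {ae mu, forall w, ev (psection_comb a c1 b c2) w = a *: ev c1 w + b *: ev c2 w}.
Proof.
move=> h1 h2; apply: filterS2 (core_ae h1) (core_ae h2) => w.
by rewrite /psection_comb /ev /sdom /= => -> ->.
Qed.

Lemma steplike0 : steplike (fun w => 0).
Proof.
apply: (steplike_ae _ (@steplike_sum 0 (fun=> setT) (fun=> fun w => None) _ _)).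
- by apply: aeW => w; rewrite big_ord0.
- by case.
- by case.
Qed.

Lemma steplikeD v1 v2 : steplike v1 -> steplike v2 ->
  steplike (fun w => v1 w + v2 w).
Proof.
move=> /steplikeP[n [A [c [mA cc hv]]]] /steplikeP[m [B [e [mB ce hv']]]].
pose AB i := match fintype.split i with inl j => A j | inr j => B j end.
pose ce' i := match fintype.split i with inl j => c j | inr j => e j end.
apply: (steplike_ae _ (@steplike_sum (n + m) AB ce' _ _)).
- apply: filterS2 hv hv' => w -> ->; rewrite big_split_ord /=.
  by congr (_ + _); apply: eq_bigr => i _; rewrite /AB /ce'
    ?(unsplitK (inl i)) ?(unsplitK (inr i)).
- by rewrite /AB => i; case: fintype.split.
- by rewrite /ce' => i; case: fintype.split.
Qed.

Lemma steplike_indic (B : set T) v : measurable B -> steplike v ->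
  steplike (fun w => (\1_B w : R[i]) *: v w).
Proof.
move=> mB /steplikeP[n [A [c [mA cc hv]]]].
apply: (steplike_ae _ (@steplike_sum n (fun i => B `&` A i) c _ cc)); last first.
  by move=> i; exact: measurableI.
apply: filterS hv => w ->; rewrite scaler_sumr; apply: eq_bigr => i _.
by rewrite scalerA indicI.
Qed.

Lemma steplikeZ (z : R[i]) v : steplike v -> steplike (fun w => z *: v w).
Proof.
move=> /steplikeP[n [A [c [mA cc hv]]]].
have cc' i : core H (psection_comb z (c i) 0 (c i)) by exact: core_comb.
apply: (steplike_ae _ (steplike_sum mA cc')).
have h := ae_ord (fun i => ev_comb z 0 (cc i) (cc i)).
apply: filterS2 hv h => w -> hw.
rewrite scaler_sumr; apply: eq_bigr => i _.
by rewrite hw scale0r addr0 !scalerA mulrC.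
Qed.

Lemma steplike_bigsum n (v : 'I_n -> forall w, H w) :
  (forall i, steplike (v i)) -> steplike (fun w => \sum_(i < n) v i w).
Proof.
elim: n v => [|n IH] v hv.
  by apply: steplike_ae steplike0; apply: aeW => w; rewrite big_ord0.
apply: (steplike_ae (v := fun w => \sum_(i < n) v (widen_ord (leqnSn n) i) w
   + v ord_max w)).
  by apply: aeW => w; rewrite big_ord_recr.
by apply: steplikeD => //; exact: IH.
Qed.

Lemma steplike_sfun (g : {sfun T >-> R}) v : steplike v ->
  steplike (fun w => (g w)%:C%C *: v w).
Proof.
move=> sv; pose s := fset_set (g @` setT).
apply: (steplike_ae (v := fun w => \sum_(i < #|`s|)
   (s`_i)%:C%C *: ((\1_(g @^-1` [set s`_i]) w : R[i]) *: v w))).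
  apply: aeW => w; rewrite [in RHS](fimfunEord g) rmorph_sum scaler_suml.
  apply: eq_bigr => i _; rewrite rmorphM /= scalerA; congr (_ * _ *: _).
  by rewrite !indicE rmorph_nat.
by apply: steplike_bigsum => i; apply/steplikeZ/steplike_indic => //.
Qed.

Definition mtotal (v : forall w, H w) := exists v_ : nat -> forall w, H w,
  (forall n, steplike (v_ n)) /\
  {ae mu, forall w, v_ n w @[n --> \oo] --> v w}.

Definition total_section (v : forall w, H w) : psection H := fun w => Some (v w).

Lemma mtotal_ev (u : msection) : mtotal (ev u).
Proof.
have [du [s [ss su]]] := msectionP u.
exists (fun n w => ev (s n) w); split=> // n; exists (s n); split=> //; exact: aeW.
Qed.

Lemma mtotal_fun x : mtotal (L0sec_fun x).
Proof. exact: mtotal_ev. Qed.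

Lemma mtotalP v : mtotal v -> measurable_section (total_section v).
Proof.
move=> [v_ [/choice[s hs] cv]]; split; first exact: aeW.
exists s; split; first by move=> n; have [] := hs n.
have h := ae_foralln (fun n => (hs n).2).
apply: filterS2 cv h => w + hw; rewrite /ev /=.
by under [in X in _ -> X]eq_cvg => n do rewrite -/(ev _ _) hw.
Qed.

Lemma mtotal0 : mtotal (fun w => 0).
Proof.
exists (fun n w => 0); split; first by move=> n; exact: steplike0.
by apply: aeW => w; exact: cvg_cst.
Qed.

Lemma mtotalD v1 v2 : mtotal v1 -> mtotal v2 -> mtotal (fun w => v1 w + v2 w).
Proof.
move=> [v1_ [s1 c1]] [v2_ [s2 c2]].
exists (fun n w => v1_ n w + v2_ n w); split.
  by move=> n; exact: steplikeD.
by apply: filterS2 c1 c2 => w; exact: cvgD.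
Qed.

Lemma mtotalZ (f : T -> R[i]) v : cmeasurable f -> mtotal v ->
  mtotal (fun w => f w *: v w).
Proof.
move=> [mr mi] [v_ [sv cv]].
have mre : measurable_fun setT (EFin \o (fun w => complex.Re (f w))).
  exact/measurable_EFinP.
have mim : measurable_fun setT (EFin \o (fun w => complex.Im (f w))).
  exact/measurable_EFinP.
have [g cg] := approximation_sfun measurableT mre.
have [h ch] := approximation_sfun measurableT mim.
exists (fun n w => (g n w)%:C%C *: v_ n w + 'i%C *: ((h n w)%:C%C *: v_ n w)).
split.
  by move=> n; apply: steplikeD; [|apply: steplikeZ]; exact: steplike_sfun.
apply: filterS cv => w cvw.
have {}cg : g n w @[n --> \oo] --> complex.Re (f w).
  exact: (fine_cvg (cg w I)).
have {}ch : h n w @[n --> \oo] --> complex.Im (f w).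
  exact: (fine_cvg (ch w I)).
pose K : numFieldType := R[i].
have cC (x : R^nat) (l : R) : x n @[n --> \oo] --> l ->
    ((x n)%:C%C : K) @[n --> \oo] --> (l%:C%C : K).
  move=> /cvgrPdist_lt xl; apply/cvgrPdist_lt => e.
  rewrite ltcE /= => /andP[/eqP e1 e0].
  near=> n; rewrite -rmorphB normc_def /= expr0n addr0 sqrtr_sqr ltcE /= e1 eqxx /=.
  by near: n; exact: xl.
rewrite [in X in _ --> X](complexE (f w)) scalerDl -scalerA.
apply: cvgD; first by apply: (@cvgZ K (H w)) => //; exact: cC.
by apply: (@cvgZ K (H w)); [exact: cvg_cst|apply: (@cvgZ K (H w)) => //; exact: cC].
Unshelve. all: by end_near. Qed.

End measurable_sections.

Section L0sec_lmodule.
Context {d : measure_display} {T : measurableType d} {R : realType}.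
Context {mu : {finite_measure set T -> \bar R}} (H : measurable_bundle mu).

Definition total_msection (v : forall w, H w) (mv : mtotal v) : msection H :=
  MSection (mtotalP mv).

Lemma L0sec_class_total (v : forall w, H w) (mv : mtotal v) :
  {ae mu, forall w, L0sec_fun (L0sec_class (total_msection mv)) w = v w}.
Proof. exact: (L0sec_classK (total_msection mv)). Qed.

Definition L0sec_zero : L0sec H := L0sec_class (total_msection (mtotal0 H)).

Definition L0sec_add (x y : L0sec H) : L0sec H :=
  L0sec_class (total_msection (mtotalD (mtotal_fun x) (mtotal_fun y))).

Definition L0sec_scale (a : L0 mu) (x : L0sec H) : L0sec H :=
  L0sec_class (total_msection
    (mtotalZ (cmfun_measurable (repr a)) (mtotal_fun x))).

Definition L0sec_opp (x : L0sec H) : L0sec H := L0sec_scale (- 1) x.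

Lemma L0sec_fun_zero : {ae mu, forall w, L0sec_fun L0sec_zero w = 0}.
Proof. exact: L0sec_class_total. Qed.

Lemma L0sec_fun_add x y : {ae mu, forall w,
  L0sec_fun (L0sec_add x y) w = L0sec_fun x w + L0sec_fun y w}.
Proof. exact: L0sec_class_total. Qed.

Lemma L0sec_fun_scale a x : {ae mu, forall w,
  L0sec_fun (L0sec_scale a x) w = L0_fun a w *: L0sec_fun x w}.
Proof. exact: L0sec_class_total. Qed.

Lemma L0sec_fun_opp x : {ae mu, forall w,
  L0sec_fun (L0sec_opp x) w = - L0sec_fun x w}.
Proof.
have h1 := L0sec_fun_scale (- 1) x; have h2 := @L0_fun_opp _ _ _ mu 1.
have h3 := @L0_fun_cst _ _ _ mu 1.
near=> w; rewrite (near h1 w)// (near h2 w)// (near h3 w)// scaleN1r //.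
Unshelve. all: by end_near. Qed.

Let addA : associative L0sec_add.
Proof.
move=> x y z; apply/L0sec_eqP.
have h1 := L0sec_fun_add x (L0sec_add y z); have h2 := L0sec_fun_add y z.
have h3 := L0sec_fun_add (L0sec_add x y) z; have h4 := L0sec_fun_add x y.
by near=> w; rewrite (near h1 w)// (near h2 w)// (near h3 w)// (near h4 w)// addrA.
Unshelve. all: by end_near. Qed.

Let addC : commutative L0sec_add.
Proof.
move=> x y; apply/L0sec_eqP.
have h1 := L0sec_fun_add x y; have h2 := L0sec_fun_add y x.
by near=> w; rewrite (near h1 w)// (near h2 w)// addrC.
Unshelve. all: by end_near. Qed.

Let add0 : left_id L0sec_zero L0sec_add.
Proof.
move=> x; apply/L0sec_eqP.
have h1 := L0sec_fun_add L0sec_zero x; have h2 := L0sec_fun_zero.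
by near=> w; rewrite (near h1 w)// (near h2 w)// add0r.
Unshelve. all: by end_near. Qed.

Let addN : left_inverse L0sec_zero L0sec_opp L0sec_add.
Proof.
move=> x; apply/L0sec_eqP.
have h1 := L0sec_fun_add (L0sec_opp x) x; have h2 := L0sec_fun_zero.
have h3 := L0sec_fun_opp x.
by near=> w; rewrite (near h1 w)// (near h2 w)// (near h3 w)// addNr.
Unshelve. all: by end_near. Qed.

HB.instance Definition _ := GRing.isZmodule.Build (L0sec H) addA addC add0 addN.

Let scaleA a b x : L0sec_scale a (L0sec_scale b x) = L0sec_scale (a * b) x.
Proof.
apply/L0sec_eqP.
have h1 := L0sec_fun_scale a (L0sec_scale b x); have h2 := L0sec_fun_scale b x.
have h3 := L0sec_fun_scale (a * b) x; have h4 := L0_fun_mul a b.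
by near=> w; rewrite (near h1 w)// (near h2 w)// (near h3 w)// (near h4 w)// scalerA.
Unshelve. all: by end_near. Qed.

Let scale1 : left_id 1 L0sec_scale.
Proof.
move=> x; apply/L0sec_eqP.
have h1 := L0sec_fun_scale 1 x; have h2 := @L0_fun_cst _ _ _ mu 1.
by near=> w; rewrite (near h1 w)// (near h2 w)// scale1r.
Unshelve. all: by end_near. Qed.

Let scaleDr : right_distributive L0sec_scale +%R.
Proof.
move=> a x y; apply/L0sec_eqP.
have h1 := L0sec_fun_scale a (x + y); have h2 := L0sec_fun_add x y.
have h3 := L0sec_fun_add (L0sec_scale a x) (L0sec_scale a y).
have h4 := L0sec_fun_scale a x; have h5 := L0sec_fun_scale a y.
by near=> w; rewrite (near h1 w)// (near h2 w)// (near h3 w)// (near h4 w)//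
  (near h5 w)// scalerDr.
Unshelve. all: by end_near. Qed.

Let scaleDl x : {morph L0sec_scale^~ x : a b / a + b}.
Proof.
move=> a b; apply/L0sec_eqP.
have h1 := L0sec_fun_scale (a + b) x; have h2 := L0_fun_add a b.
have h3 := L0sec_fun_add (L0sec_scale a x) (L0sec_scale b x).
have h4 := L0sec_fun_scale a x; have h5 := L0sec_fun_scale b x.
by near=> w; rewrite (near h1 w)// (near h2 w)// (near h3 w)// (near h4 w)//
  (near h5 w)// scalerDl.
Unshelve. all: by end_near. Qed.

HB.instance Definition _ := GRing.Zmodule_isLmodule.Build (L0 mu) (L0sec H)
  scaleA scale1 scaleDr scaleDl.

End L0sec_lmodule.

Section L0sec_norm.
Context {d : measure_display} {T : measurableType d} {R : realType}.
Context {mu : {finite_measure set T -> \bar R}} (muC : measure_is_complete mu).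
Context {H : measurable_bundle mu}.

Lemma ae_measurable_real (f g : T -> R) : {ae mu, forall w, f w = g w} ->
  measurable_fun setT f -> measurable_fun setT g.
Proof.
move=> fg /measurable_EFinP mf; apply/measurable_EFinP.
apply: (ae_measurable_fun muC _ mf).
by apply: filterS fg => w /= ->.
Qed.

Lemma measurable_real_cvg (f_ : nat -> T -> R) (f : T -> R) :
  (forall n, measurable_fun setT (f_ n)) ->
  {ae mu, forall w, f_ n w @[n --> \oo] --> f w} -> measurable_fun setT f.
Proof.
move=> mf [N [mN N0 sN]].
apply: (ae_measurable_real (f := fun w => f w * \1_(~` N) w)).
  exists N; split=> // w /= h; apply: contrapT => nN; apply: h.
  by rewrite indicE mem_set// mulr1.
apply: (@measurable_fun_cvg _ _ _ setT (fun n w => f_ n w * \1_(~` N) w)).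
  move=> n; apply: measurable_funM => //.
  by apply: measurable_indic; exact: measurableC.
move=> w _; have [Nw|nNw] := EM (N w).
  rewrite indicE memNset; last by move=> /(_ Nw).
  rewrite mulr0; under eq_fun do rewrite mulr0; exact: cvg_cst.
apply: cvgM; last exact: cvg_cst.
by apply: contrapT => h; apply: nNw; exact: sN.
Qed.

Lemma measurable_norm_core c : core H c ->
  measurable_fun setT (fun w => complex.Re `|ev c w|).
Proof.
move=> cc; have mD : measurable (sdom c).
  rewrite -(setCK (sdom c)); apply: measurableC; apply: muC.
  by have := core_ae cc.
have /(measurable_restrictT _ mD) := core_norm cc.
congr measurable_fun; apply/funext => w; rewrite /patch.
case: ifPn => // /negP; rewrite inE /sdom /ev /=.
by case: (c w) => //= _; rewrite normr0.
Qed.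

Lemma measurable_norm_steplike (v : forall w, H w) : steplike v ->
  measurable_fun setT (fun w => complex.Re `|v w|).
Proof.
move=> /steplikeP[n [A [c [mA cc hv]]]].
apply: (ae_measurable_real (f := fun w => complex.Re
    `|\sum_(i < n) (\1_(A i) w : R[i]) *: ev (c i) w|)).
  by apply: filterS hv => w ->.
case: n A c mA cc {hv} => [|n] A c mA cc.
  apply: (eq_measurable_fun (fun=> 0 : R)); last exact: measurable_cst.
  by move=> w _; rewrite big_ord0 normr0.
pose c0 := psection_comb 0 (c ord0) 0 (c ord0).
have cc0 : core H c0 by exact: core_comb.
apply: (ae_measurable_real (f := fun w => complex.Re
    `|ev c0 w + \sum_(i < n.+1) (\1_(A i) w : R[i]) *: ev (c i) w|)).
  apply: filterS (ev_comb 0 0 (cc ord0) (cc ord0)) => w ->.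
  by rewrite !scale0r !add0r.
move: c0 cc0; move: {n}n.+1 A c mA cc => n A c mA cc c0 cc0.
elim: n A c mA cc c0 cc0 => [|n IH] A c mA cc c0 cc0.
  apply: eq_measurable_fun (measurable_norm_core cc0) => w _.
  by rewrite big_ord0 addr0.
pose S w := \sum_(i < n) (\1_(A (lift ord0 i)) w : R[i]) *: ev (c (lift ord0 i)) w.
pose c1 := psection_comb 1 c0 1 (c ord0).
have cc1 : core H c1 by exact: core_comb.
apply: (ae_measurable_real (f := fun w => if w \in A ord0 then
  complex.Re `|ev c1 w + S w| else complex.Re `|ev c0 w + S w|)).
  apply: filterS (ev_comb 1 1 cc0 (cc ord0)) => w hw.
  rewrite big_ord_recl -/(S w) indicE hw !scale1r.
  by case: (w \in A ord0); rewrite ?scale1r ?scale0r ?add0r ?addrA.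
apply: measurable_fun_ifT; last 2 first.
- by apply: IH.
- by apply: IH.
apply: (measurable_fun_bool true); rewrite setTI.
rewrite (_ : _ @^-1` _ = A ord0) //; apply/seteqP; split=> w /=.
  by move=> Aw; apply: set_mem.
by move=> Aw; rewrite mem_set.
Qed.

Lemma cmeasurable_norm (v : forall w, H w) : mtotal v ->
  cmeasurable (fun w => `|v w|).
Proof.
move=> [v_ [sv cv]]; split; last first.
  apply: (eq_measurable_fun (fun=> 0 : R)); last exact: measurable_cst.
  by move=> w _; rewrite ger0_Im.
apply: (measurable_real_cvg (f_ := fun n w => complex.Re `|v_ n w|)).
  by move=> n; exact: measurable_norm_steplike.
apply: filterS cv => w /cvgrPdist_lt cv; apply/cvgrPdist_lt => e e0.
have e0' : 0 < e%:C%C by rewrite ltcR.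
apply: filterS (cv _ e0') => n; rewrite -raddfB /= => h.
rewrite -ltcR; apply: le_lt_trans h; apply: le_trans (ler_dist_dist _ _).
exact: normc_ge_Re.
Qed.

Definition L0norm (x : L0sec H) : L0 mu :=
  L0_class mu (CMFun (cmeasurable_norm (mtotal_fun x))).

Lemma L0_fun_norm x : {ae mu, forall w, L0_fun (L0norm x) w = `|L0sec_fun x w|}.
Proof.
have h := @L0_classK _ _ _ mu (CMFun (cmeasurable_norm (mtotal_fun x))).
by apply: filterS h => w ->.
Qed.

Lemma L0norm_ge0 x : 0 <= L0norm x.
Proof.
apply/L0_leP; have h1 := L0_fun_norm x; have h2 := @L0_fun_cst _ _ _ mu 0.
near=> w; rewrite (near h1 w)// (near h2 w)// normr_ge0 //.
Unshelve. all: by end_near. Qed.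

End L0sec_norm.

Section L0_sup.
Context {d : measure_display} {T : measurableType d} {R : realType}.
Context {mu : {finite_measure set T -> \bar R}} (muC : measure_is_complete mu).

Let phi (x : R) : R := expR (- expR (- x)).

Let phi_le x y : (phi x <= phi y) = (x <= y).
Proof. by rewrite /phi ler_expR lerN2 ler_expR lerN2. Qed.

Let phi_max x y : phi (Num.max x y) = Num.max (phi x) (phi y).
Proof. by rewrite !maxEle phi_le; case: ifP. Qed.

Let phi_measurable (f : T -> R) : measurable_fun setT f ->
  measurable_fun setT (phi \o f).
Proof.
move=> mf.
apply: (measurableT_comp (f := expR) (g := fun w => - expR (- f w))) => //.
apply: (@measurable_funN _ _ _ _ (fun w => expR (- f w))).
apply: (measurableT_comp (f := expR) (g := fun w => - f w)) => //.
exact: measurable_funN.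
Qed.

Let phi_integrable (f : T -> R) : measurable_fun setT f ->
  mu.-integrable setT (EFin \o (phi \o f)).
Proof.
move=> mf; apply: measurable_bounded_integrable => //.
- by rewrite ltey_eq fin_num_measure.
- exact: phi_measurable.
- exists 1; split=> // M M1 w _ /=; rewrite ger0_norm ?expR_ge0//.
  apply: le_trans (ltW M1); rewrite -[leRHS]expR0 ler_expR oppr_le0.
  exact: expR_ge0.
Qed.

Let I (f : T -> R) : R := \int[mu]_(w in setT) phi (f w).

Let I_le (f g : T -> R) : measurable_fun setT f -> measurable_fun setT g ->
  (forall w, f w <= g w) -> I f <= I g.
Proof.
move=> mf mg fg; apply: le_Rintegral => //; first exact: phi_integrable.
  exact: phi_integrable.
by move=> w _; rewrite phi_le.
Qed.

Lemma ess_sup_family (F : set (T -> R)) (B : T -> R) :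
  F !=set0 -> (forall f, F f -> measurable_fun setT f) ->
  (forall f, F f -> {ae mu, forall w, f w <= B w}) ->
  exists g : T -> R, [/\ measurable_fun setT g,
    forall f, F f -> {ae mu, forall w, f w <= g w} &
    forall h : T -> R, (forall f, F f -> {ae mu, forall w, f w <= h w}) ->
      {ae mu, forall w, g w <= h w}].
Proof.
move=> [f0 Ff0] mF FB.
pose mx (s : seq (T -> R)) w := foldr (fun f r => Num.max (f w) r) (f0 w) s.
pose ok (s : seq (T -> R)) := forall f, f \in s -> F f.
have mx_meas s : ok s -> measurable_fun setT (mx s).
  elim: s => [_|f s IH oks]; first exact: mF.
  apply: measurable_maxr; first by apply: mF; apply: oks; rewrite mem_head.
  by apply: IH => g gs; apply: oks; rewrite in_cons gs orbT.
have mx_le s h : ok s -> (forall f, F f -> {ae mu, forall w, f w <= h w}) ->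
    {ae mu, forall w, mx s w <= h w}.
  move=> + hF; elim: s => [_|f s IH oks]; first exact: hF.
  have /IH h1 : ok s by move=> g gs; apply: oks; rewrite in_cons gs orbT.
  have h2 : {ae mu, forall w, f w <= h w}.
    by apply: hF; apply: oks; rewrite mem_head.
  by apply: filterS2 h1 h2 => w; rewrite /mx /= ge_max => -> ->.
have mx_catr s t w : mx t w <= mx (s ++ t) w.
  by elim: s => //= f s IH; rewrite /mx /= le_max IH orbT.
have mx_catl s t w : mx s w <= mx (s ++ t) w.
  elim: s => /= [|f s IH].
    by elim: t => //= f t IH; rewrite /mx /= le_max IH orbT.
  by rewrite /mx /= ge_max !le_max lexx /= IH orbT.
have ok_cat s t : ok s -> ok t -> ok (s ++ t).
  by move=> os ot f; rewrite mem_cat => /orP[/os|/ot].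
pose J := [set I (mx s) | s in [set s | ok s]].
have supJ : has_sup J.
  split; first by exists (I (mx [::])); exists [::].
  exists (\int[mu]_(w in setT) 1); move=> _ [s /= os <-].
  apply: le_Rintegral => //; first by apply: phi_integrable; exact: mx_meas.
    apply: measurable_bounded_integrable => //.
      by rewrite ltey_eq fin_num_measure.
    by exists 1; split=> // M M1 w _ /=; rewrite normr1 ltW.
  by move=> w _; rewrite -[leRHS]expR0 ler_expR oppr_le0 expR_ge0.
have /choice[s_ hs] : forall n, exists s, ok s /\ sup J - n.+1%:R^-1 < I (mx s).
  move=> n; have [|_ [s os <-] h] := @sup_adherent _ J n.+1%:R^-1 _ supJ.
    by rewrite invr_gt0.
  by exists s.
pose fix t_ n := if n is n'.+1 then s_ n'.+1 ++ t_ n' else s_ 0%N.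
have ot n : ok (t_ n).
  elim: n => [|n IH]; first exact: (hs 0%N).1.
  by apply: ok_cat => //; exact: (hs n.+1).1.
pose g_ n := mx (t_ n).
have mg_ n : measurable_fun setT (g_ n) by exact: mx_meas.
have ndg w : nondecreasing_seq (g_ ^~ w).
  by apply/nondecreasing_seqP => n; exact: mx_catr.
have Ig n : sup J - n.+1%:R^-1 <= I (g_ n).
  apply: le_trans (ltW (hs n).2) _; apply: I_le => //.
    by apply: mx_meas; exact: (hs n).1.
  by case: n => [|n] w //=; exact: mx_catl.
have cvg_g h : (forall f, F f -> {ae mu, forall w, f w <= h w}) ->
    {ae mu, forall w, cvgn (g_ ^~ w) /\ limn (g_ ^~ w) <= h w}.
  move=> hF; have := ae_foralln (fun n => mx_le (t_ n) h (ot n) hF).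
  apply: filterS => w hw.
  have cw : cvgn (g_ ^~ w).
    apply: nondecreasing_is_cvgn => //; exists (h w) => _ [n _ <-]; exact: hw.
  by split=> //; apply: limr_le => //; apply: nearW => n; exact: hw.
pose g w := limn (g_ ^~ w).
have mg : measurable_fun setT g.
  apply: (measurable_real_cvg muC mg_).
  by apply: filterS (cvg_g B FB) => w [].
exists g; split => //; last first.
  by move=> h hF; apply: filterS (cvg_g h hF) => w [].
move=> f Ff; have mf := mF _ Ff.
pose D (k : T -> R) w := phi (Num.max (f w) (k w)) - phi (k w).
have mmax k : measurable_fun setT k -> measurable_fun setT (fun w => Num.max (f w) (k w)).
  by move=> mk; exact: measurable_maxr.
have D0 k w : 0 <= D k w by rewrite subr_ge0 phi_le le_max lexx orbT.
have mD k : measurable_fun setT k -> measurable_fun setT (D k).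
  move=> mk; apply: measurable_funB; last exact: phi_measurable.
  by apply: (@phi_measurable (fun w => Num.max (f w) (k w))); exact: mmax.
have iD k : measurable_fun setT k ->
    \int[mu]_(w in setT) D k w = I (fun w => Num.max (f w) (k w)) - I k.
  move=> mk; rewrite RintegralB//.
    by apply: (@phi_integrable (fun w => Num.max (f w) (k w))); exact: mmax.
  exact: phi_integrable.
have Dg_ n : \int[mu]_(w in setT) D (g_ n) w <= n.+1%:R^-1.
  rewrite iD// lerBlDr addrC -lerBlDr; apply: le_trans (Ig n).
  rewrite lerB//; apply: ub_le_sup; first exact: supJ.2.
  exists (f :: t_ n) => //= k; rewrite in_cons => /orP[/eqP ->//|/ot].
  done.
have integD k : measurable_fun setT k -> mu.-integrable setT (EFin \o D k).
  move=> mk.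
  have := integrableB measurableT (phi_integrable (mmax _ mk)) (phi_integrable mk).
  by [].
have Dle : {ae mu, forall w, forall n, D g w <= D (g_ n) w}.
  apply: filterS (cvg_g B FB) => w [cw _] n.
  have : phi (g_ n w) <= phi (g w) by rewrite phi_le; exact: nondecreasing_cvgn_le.
  rewrite /D !phi_max !maxEle.
  move: (phi (f w)) (phi (g w)) (phi (g_ n w)) => a b c cb.
  by case: (leP a b) => h1; case: (leP a c) => h2; lra.
have ID0 : \int[mu]_(w in setT) D g w = 0.
  apply/eqP; rewrite eq_le Rintegral_ge0// andbT.
  apply/ler_addgt0Pl => e e0; rewrite addr0.
  have [n ne] : exists n, n.+1%:R^-1 < e.
    by have [n _ /(_ _ (leqnn n))] := near_infty_natSinv_lt (PosNum e0); exists n.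
  apply: le_trans (ltW ne); apply: le_trans (Dg_ n).
  apply: fine_le.
  - exact: integrable_fin_num (integD _ mg).
  - exact: integrable_fin_num (integD _ (mg_ n)).
  apply: ae_ge0_le_integral => //.
  - by move=> w _; rewrite lee_fin.
  - exact/measurable_EFinP/mD.
  - by move=> w _; rewrite lee_fin.
  - exact/measurable_EFinP/mD.
  by apply: filterS Dle => w h _; rewrite lee_fin.
have : (\int[mu]_(w in setT) `|(D g w)%:E| = 0)%E.
  have fi := integrable_fin_num measurableT (integD _ mg).
  transitivity (\int[mu]_(w in setT) (EFin \o D g) w)%E.
    by apply: eq_integral => w _ /=; rewrite ger0_norm.
  by rewrite -(fineK fi); congr (_%:E); exact: ID0.
move=> /(ae_eq_integral_abs mu measurableT) h.
have {}h := h (proj2 (measurable_EFinP _ _) (mD _ mg)).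
apply: filterS h => w /(_ Logic.I) /= [].
rewrite /D => /eqP; rewrite subr_eq0 => /eqP h.
rewrite -phi_le -h phi_le le_max lexx //.
Qed.

Lemma L0_supremum_exists (A : set (L0 mu)) :
  A !=set0 -> has_ubound A -> supremums A !=set0.
Proof.
move=> [a Aa] [b Ab].
pose F := [set f | exists2 x : L0 mu, A x & f = (fun w => complex.Re (L0_fun x w))].
have [|||g [mg Fg gF]] := @ess_sup_family F (fun w => complex.Re (L0_fun b w)).
- by exists (fun w => complex.Re (L0_fun a w)); exists a.
- by move=> _ [x Ax ->]; exact: (cmfun_measurable (repr x)).1.
- move=> _ [x /Ab /L0_leP xb ->]; apply: filterS xb => w.
  by rewrite lecE => /andP[].
have ms : cmeasurable (fun w => (g w +i* complex.Im (L0_fun b w))%C).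
  by split => //=; exact: (cmfun_measurable (repr b)).2.
have hs := @L0_classK _ _ _ mu (CMFun ms).
exists (L0_class mu (CMFun ms)); split.
  move=> x Ax; apply/L0_leP.
  have /L0_leP xb := Ab _ Ax.
  have xg : {ae mu, forall w, complex.Re (L0_fun x w) <= g w}.
    by apply: Fg; exists x.
  apply: filterS3 hs xb xg => w /(_ Logic.I) -> /=.
  by rewrite !lecE /= => /andP[-> _].
move=> c Ac; apply/L0_leP.
have /L0_leP ac := Ac _ Aa; have /L0_leP ab := Ab _ Aa.
have gc : {ae mu, forall w, g w <= complex.Re (L0_fun c w)}.
  apply: gF => _ [x /Ac /L0_leP xc ->]; apply: filterS xc => w.
  by rewrite lecE => /andP[].
have {ab}abi : {ae mu, forall w,
    complex.Im (L0_fun c w) = complex.Im (L0_fun b w)}.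
  apply: filterS2 ac ab => w; rewrite !lecE.
  by move=> /andP[/eqP -> _] /andP[/eqP -> _].
apply: filterS3 hs abi gc => w /(_ Logic.I) -> /=.
by rewrite !lecE /= => -> ->; rewrite eqxx.
Qed.

End L0_sup.

Section bo_structure.
Context {d : measure_display} {T : measurableType d} {R : realType}.
Context {mu : {finite_measure set T -> \bar R}} (muC : measure_is_complete mu).
Context {H : measurable_bundle mu}.

Definition order_bounded (A : set (L0 mu)) :=
  exists a b : L0 mu, forall x, A x -> a <= x <= b.

Definition bounded_subset (B : set (L0sec H)) :=
  order_bounded (L0norm muC @` B).

Definition L0_bounded (S : L0sec H -> L0sec H) :=
  forall B, bounded_subset B -> bounded_subset (S @` B).

Definition opnorm_set (S : L0sec H -> L0sec H) : set (L0 mu) :=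
  [set L0norm muC (S x) | x in [set x | L0norm muC x <= 1]].

(* [supremum] takes the default value [0] if there is no supremum; by
   [opnormP] below this does not happen when [S] is [L0]-bounded. *)
Definition opnorm (S : L0sec H -> L0sec H) : L0 mu :=
  supremum 0 (opnorm_set S).

Lemma L0norm0 : L0norm muC (0 : L0sec H) = 0.
Proof.
apply/L0_eqP; have h1 := L0_fun_norm muC (0 : L0sec H).
have h2 := L0sec_fun_zero H; have h3 := @L0_fun_cst _ _ _ mu 0.
near=> w => _; rewrite (near h1 w)// (near h2 w)// (near h3 w)// normr0 //.
Unshelve. all: by end_near. Qed.

Lemma L0_le01 : (0 : L0 mu) <= 1.
Proof.
apply/L0_leP; have h1 := @L0_fun_cst _ _ _ mu 1.
have h2 := @L0_fun_cst _ _ _ mu 0.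
near=> w; rewrite (near h1 w)// (near h2 w)// ler01 //.
Unshelve. all: by end_near. Qed.

Lemma opnormP S : L0_bounded S -> supremums (opnorm_set S) (opnorm S).
Proof.
move=> Sb; have ne : opnorm_set S !=set0.
  by exists (L0norm muC (S 0)), 0 => //=; rewrite L0norm0 L0_le01.
have [a [b Sab]] : order_bounded (L0norm muC @` (S @` [set x | L0norm muC x <= 1])).
  by apply: Sb; exists 0, 1 => _ [x /= x1 <-]; rewrite x1 andbT L0norm_ge0.
have ub : has_ubound (opnorm_set S).
  exists b => _ [x x1 <-]; suff /Sab/andP[] : (L0norm muC @`
    (S @` [set x | L0norm muC x <= 1])) (L0norm muC (S x)) by [].
  by exists (S x) => //; exists x.
have [s hs] := L0_supremum_exists muC ne ub.
rewrite /opnorm /supremum; case: eqP => [e|_]; first by move: ne; rewrite e => -[].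
exact: (xgetPex 0 (ex_intro _ s hs)).
Qed.

Definition L0_contraction (S : {linear L0sec H -> L0sec H}) :=
  L0_bounded S /\ opnorm S <= 1.

Definition directed (I : Type) (leI : I -> I -> Prop) :=
  [/\ exists i : I, True, forall i, leI i i,
      forall i j k, leI i j -> leI j k -> leI i k &
      forall i j, exists k, leI i k /\ leI j k].

Definition bo_cvg (I : Type) (leI : I -> I -> Prop) (x_ : I -> L0sec H)
    (x : L0sec H) :=
  exists (G : Type) (leG : G -> G -> Prop) (e : G -> L0 mu),
  [/\ directed leG,
      forall g g', leG g g' -> e g' <= e g,
      infimums (range e) 0 &
      forall g, exists i0, forall i, leI i0 i -> L0norm muC (x - x_ i) <= e g].

End bo_structure.

Fixpoint nested_sum (V : nmodType) (ns : seq nat) (F : seq nat -> V) : V :=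
  if ns is n :: ns' then \sum_(i < n) nested_sum ns' (fun s => F (nat_of_ord i :: s))
  else F [::].

Section average.
Context {d : measure_display} {T : measurableType d} {R : realType}.
Context {mu : {finite_measure set T -> \bar R}} {H : measurable_bundle mu}.

(* With [s] the sequence of exponents, the iterated composition is
   [S_0 ^ s_0 (S_1 ^ s_1 (... u))]. If some [tnth n j] is [0] then the value is
   the junk value [0], which is irrelevant for limits along large [n]. *)
Definition ergodic_average k (S : 'I_k -> L0sec H -> L0sec H)
    (n : k.-tuple nat) (u : L0sec H) : L0sec H :=
  L0_cst mu ((\prod_(j < k) (tnth n j)%:R)^-1) *:
  nested_sum n (fun s =>
    (\big[(fun f g => f \o g)/id]_(j < k) iter (nth 0%N s j) (S j)) u).

End average.

Definition coordwise_le k (m n : k.-tuple nat) : Prop :=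
  forall j, (tnth m j <= tnth n j)%N.

(* Main.v *)
(* For an L0-contraction S and a section u, almost every w satisfies all the
   inequalities |sum_(i in s) (S^(i+1) u)(w)| <= |sum_(i in s) (S^i u)(w)|, s
   ranging over the countably many finite sequences of naturals. This suffices
   to run F. Riesz's proof of von Neumann's mean ergodic theorem in the fibre
   over w, so the averages of a single operator converge a.e., hence in the
   (bo) sense. The multiparameter average is the composition of averages
   A_n1(T_1) ... A_nd(T_d) u, and convergence follows by induction on d from
   |x - A_m(S) y_i| <= |y - y_i| + |x - A_m(S) y|; commutation plays no role. *)
Require Import Defs.
From mathcomp Require Import all_boot all_order all_algebra.
From mathcomp Require Import complex ring lra.
From mathcomp Require Import all_classical all_reals all_analysis.
From mathcomp Require Import measurable_realfun.

Set Implicit Arguments.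
Unset Strict Implicit.
Unset Printing Implicit Defensive.

Import Order.TTheory GRing.Theory Num.Theory ComplexField.
Import numFieldTopology.Exports numFieldNormedType.Exports.

Local Open Scope classical_set_scope.
Local Open Scope ring_scope.

(** * The norm of a normed space over [R[i]] as a real number *)

Section real_norm.
Context {R : realType} {V : normedModType R[i]}.
Implicit Types (x y : V).

(** [|x|] takes values in [R[i]]; passing to [R] makes infima, suprema and real arithmetic
    available. *)
Definition rnorm x : R := complex.Re `|x|.

Lemma rnormE x : `|x| = (rnorm x)%:C%C.
Proof. by rewrite /rnorm RRe_real// ger0_real. Qed.

Lemma rnorm_ge0 x : 0 <= rnorm x.
Proof. by rewrite -lecR -rnormE normr_ge0. Qed.

Lemma rnorm0 : rnorm (0 : V) = 0.
Proof. by rewrite /rnorm normr0. Qed.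

Lemma rnormN x : rnorm (- x) = rnorm x.
Proof. by rewrite /rnorm normrN. Qed.

Lemma ler_rnormD x y : rnorm (x + y) <= rnorm x + rnorm y.
Proof. by rewrite -lecR rmorphD /= -!rnormE ler_normD. Qed.

Lemma ler_rnormB x y : rnorm (x - y) <= rnorm x + rnorm y.
Proof. by rewrite -(rnormN y); exact: ler_rnormD. Qed.

Lemma rnormZ (a : R) x : 0 <= a -> rnorm (a%:C%C *: x) = a * rnorm x.
Proof.
move=> a0; apply: complexI; rewrite -rnormE normrZ rnormE rmorphM /=.
by rewrite ger0_norm// lecR.
Qed.

Lemma rnorm_natmul n x : rnorm (x *+ n) = n%:R * rnorm x.
Proof. by rewrite -scaler_nat -(rmorph_nat (real_complex R)) rnormZ. Qed.

Lemma rnorm_natV n x : rnorm ((n%:R : R[i])^-1 *: x) = n%:R^-1 * rnorm x.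
Proof. by rewrite -(rmorph_nat (real_complex R)) -fmorphV rnormZ ?invr_ge0. Qed.

Lemma ler_rnorm_sum (I : Type) (r : seq I) (F : I -> V) :
  rnorm (\sum_(i <- r) F i) <= \sum_(i <- r) rnorm (F i).
Proof.
elim: r => [|i r IH]; first by rewrite !big_nil rnorm0.
by rewrite !big_cons (le_trans (ler_rnormD _ _))// lerD2l.
Qed.

(** Positivity of [e] in [R[i]] forces [e] to be real, so real tolerances suffice. *)
Lemma cvg_rnormP (I : Type) (F : set_system I) (FF : Filter F) (f : I -> V) y :
  f @ F --> y <-> forall e : R, 0 < e -> \forall i \near F, rnorm (y - f i) < e.
Proof.
split=> [/cvgrPdist_lt h e e0|h].
  have := h e%:C%C; rewrite ltcR => /(_ e0).
  by apply: filterS => i; rewrite rnormE ltcR.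
apply/cvgrPdist_lt => e e0.
have eR : e = (complex.Re e)%:C%C by rewrite RRe_real// ger0_real// ltW.
rewrite eR ltcR in e0; apply: filterS (h _ e0) => i.
by rewrite rnormE [in X in _ -> X]eR ltcR.
Qed.

End real_norm.

Lemma rnorm_cauchy_cvg (R : realType) (V : completeNormedModType R[i])
    (f : nat -> V) :
  (forall e : R, 0 < e -> exists N, forall m n, (N <= m)%N -> (N <= n)%N ->
    rnorm (f m - f n) < e) -> cvgn f.
Proof.
move=> h; apply: cauchy_cvg; apply: cauchy_exP => e e0.
have eR : e = (complex.Re e)%:C%C by rewrite RRe_real// ger0_real// ltW.
have e0' : 0 < complex.Re e by rewrite eR ltcR in e0.
have [N hN] := h _ e0'; exists (f N), N => // n /= Nn.
by rewrite -ball_normE /= rnormE eR ltcR hN.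
Qed.

(** * The mean ergodic theorem for one orbit in a Hilbert space *)

Section mean_ergodic.
Context {R : realType} {V : hilbertType R}.
Implicit Types (x y : V).

Lemma inner_addr x y z : inner z (x + y) = inner z x + inner z y :> R[i].
Proof.
have := inner_linear 1 x y z; rewrite scale1r mul1r => h.
by rewrite inner_conj h rmorphD /= -!inner_conj.
Qed.

Lemma inner_addl x y z : inner (x + y) z = inner x z + inner y z :> R[i].
Proof. by have := inner_linear 1 x y z; rewrite scale1r mul1r. Qed.

Lemma inner_scalel (a : R[i]) x z : inner (a *: x) z = a * inner x z.
Proof.
have i0 : inner 0 z = 0 :> R[i].
  by apply: (addrI (inner 0 z)); rewrite -inner_addl !addr0.
by rewrite -[a *: x]addr0 inner_linear i0 addr0.
Qed.

Lemma parallelogram x y :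
  rnorm (x + y) ^+ 2 + rnorm (x - y) ^+ 2 = 2 * rnorm x ^+ 2 + 2 * rnorm y ^+ 2.
Proof.
have iN u : inner (- y) u = - inner y u :> R[i].
  by rewrite -scaleN1r inner_scalel mulN1r.
have iNr u : inner u (- y) = - inner u y :> R[i].
  by rewrite inner_conj iN rmorphN /= -inner_conj.
have nE (u : V) : (rnorm u)%:C%C * (rnorm u)%:C%C = inner u u :> R[i].
  by rewrite inner_norm -rnormE.
apply: complexI; rewrite !(rmorphD, rmorphM, rmorphXn) /= !nE.
rewrite !inner_addr !inner_addl !iN !iNr.
ring.
Qed.

(** [v] stands for an orbit read in one fibre, and [v_shift] for the contractivity of the operator.
    Since [s] may repeat indices, the means of [v] over nonempty [s] are exactly the rational convex
    combinations of the orbit. *)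
Variable v : nat -> V.
Hypothesis v_shift : forall s : seq nat,
  rnorm (\sum_(i <- s) v i.+1) <= rnorm (\sum_(i <- s) v i).

Let average n : V := (n%:R : R[i])^-1 *: \sum_(k < n) v k.

Let shift_iter (s : seq nat) k :
  rnorm (\sum_(i <- s) v (k + i)) <= rnorm (\sum_(i <- s) v i).
Proof.
elim: k => [//|k IH]; apply: le_trans IH.
by have := v_shift (map (addn k) s); rewrite !big_map.
Qed.

Let v_le k : rnorm (v k) <= rnorm (v 0).
Proof. by have := shift_iter [:: 0%N] k; rewrite !big_seq1 addn0. Qed.

(** Each shift of the window by one gains one term and loses one, both of norm at most
    [rnorm (v 0)]. *)
Let shift_sum n i :
  rnorm (\sum_(k < n) v k - \sum_(k < n) v (i + k)) <= i%:R * (2 * rnorm (v 0)).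
Proof.
elim: i => [|i IH]; first by rewrite subrr rnorm0 mul0r.
have -> : \sum_(k < n) v (i.+1 + k) = \sum_(k < n) v (i + k) + (v (i + n) - v i).
  have e : v i + \sum_(k < n) v (i.+1 + k) = \sum_(k < n) v (i + k) + v (i + n).
    transitivity (\sum_(k < n.+1) v (i + k)); last by rewrite big_ord_recr.
    rewrite big_ord_recl /= addn0; congr (_ + _); apply: eq_bigr => k _.
    by rewrite /bump /= add1n addnS addSn.
  by rewrite addrA -e addrC addKr.
rewrite opprD addrA (le_trans (ler_rnormB _ _))// -natr1 mulrDl mul1r.
by rewrite lerD// (le_trans (ler_rnormB _ _))// mulr_natl mulr2n lerD.
Qed.

(** Replacing the window by its shifts by the [i] in [s] costs an error independent of [n], by
    [shift_sum]. Exchanging the sums then leaves [n] shifted copies of the sum over [s], none larger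
    than the original. *)
Let average_le s : s != [::] -> exists C : R, forall n, (0 < n)%N ->
  rnorm (average n) <= (size s)%:R^-1 * rnorm (\sum_(i <- s) v i) + n%:R^-1 * C.
Proof.
move=> s0; have szs : 0 < (size s)%:R :> R by rewrite ltr0n lt0n size_eq0.
pose D := \sum_(i <- s) i%:R * (2 * rnorm (v 0)).
exists ((size s)%:R^-1 * D) => n n0.
have n0' : 0 < n%:R :> R by rewrite ltr0n.
rewrite rnorm_natV -(ler_pM2l n0') -(ler_pM2l szs) mulrDr.
rewrite (mulrA n%:R n%:R^-1) mulfV ?gt_eqF// mul1r.
rewrite (mulrA n%:R n%:R^-1) mulfV ?gt_eqF// mul1r mulrDr mulrCA.
rewrite !(mulrA (size s)%:R _^-1) !mulfV ?gt_eqF// !mul1r.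
have -> : (size s)%:R * rnorm (\sum_(k < n) v k) =
    rnorm (\sum_(i <- s) \sum_(k < n) v k).
  by rewrite big_const_seq count_predT iter_addr_0 rnorm_natmul.
have -> : \sum_(i <- s) \sum_(k < n) v k = \sum_(i <- s) \sum_(k < n) v (i + k)
    + \sum_(i <- s) (\sum_(k < n) v k - \sum_(k < n) v (i + k)).
  by rewrite -big_split; apply: eq_bigr => i _; rewrite /= addrC subrK.
rewrite (le_trans (ler_rnormD _ _))// lerD//; last first.
  by rewrite (le_trans (ler_rnorm_sum _ _))// ler_sum.
rewrite exchange_big (le_trans (ler_rnorm_sum _ _))//=.
rewrite (@le_trans _ _ (\sum_(k < n) rnorm (\sum_(i <- s) v i)))//.
  apply: ler_sum => k _; apply: le_trans (shift_iter s k).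
  by under eq_bigr do rewrite addnC.
by rewrite sumr_const card_ord mulr_natl.
Qed.

(* F. Riesz: the averages are asymptotically of minimal norm in the convex hull
   of the orbit, and the midpoint of two averages is again in that hull, so the
   parallelogram law makes them a Cauchy sequence. *)
Lemma mean_ergodic_cvg : cvgn average.
Proof.
pose J := [set r : R | exists2 s : seq nat, s != [::] &
  r = (size s)%:R^-1 * rnorm (\sum_(i <- s) v i)].
have J0 r : J r -> 0 <= r.
  by move=> [s _ ->]; rewrite mulr_ge0 ?invr_ge0 ?rnorm_ge0.
have infJ : has_inf J.
  split; last by exists 0 => r /J0.
  by exists (1^-1 * rnorm (\sum_(i <- [:: 0%N]) v i)); exists [:: 0%N].
pose a := inf J.
have a0 : 0 <= a by apply: lb_le_inf => [|r /J0]//; exact: infJ.1.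
have le_a s : s != [::] -> a * (size s)%:R <= rnorm (\sum_(i <- s) v i).
  move=> s0; have szs : 0 < (size s)%:R :> R by rewrite ltr0n lt0n size_eq0.
  rewrite -ler_pdivlMr// mulrC; apply: ge_inf; first exact: infJ.2.
  by exists s.
apply: rnorm_cauchy_cvg => e e0.
(* If both averages have norm at most [a + t] and their sum has norm at least [2 * a], the
   parallelogram law bounds the squared distance by [4 * (a + t) ^+ 2 - 4 * a ^+ 2], which is
   [8 * a * t + 4 * t ^+ 2]. As [t <= 1], this is less than [t * (8 * a + 5)]. *)
pose t := Num.min 1 (e ^+ 2 / (8 * a + 5)).
have c0 : 0 < 8 * a + 5 by lra.
have t0 : 0 < t by rewrite lt_min ltr01 divr_gt0 ?exprn_gt0.
have te : 8 * a * t + 4 * t ^+ 2 < e ^+ 2.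
  have t1 : t <= 1 by rewrite ge_min lexx.
  have : t * (8 * a + 5) <= e ^+ 2 by rewrite -ler_pdivlMr// ge_min lexx orbT.
  by nra.
have [N hN] : exists N, forall n, (N <= n)%N -> (0 < n)%N /\ rnorm (average n) <= a + t.
  have t20 : 0 < t / 2 by rewrite divr_gt0.
  have [_ [s s0 ->] hs] := inf_adherent t20 infJ.
  have [C hC] := average_le s0.
  (* From this [N] on, the error [C / n] of [average_le] is at most [t / 2]. *)
  pose N := (Num.truncn (`|C| / (t / 2))).+1.
  exists N => n Nn; have n0 : (0 < n)%N by exact: leq_trans Nn.
  split=> //; apply: le_trans (hC n n0) _.
  have n0' : 0 < n%:R :> R by rewrite ltr0n.
  suff : n%:R^-1 * C <= t / 2 by rewrite -/a in hs; lra.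
  rewrite mulrC ler_pdivrMr// mulrC -ler_pdivrMr//.
  apply: (@le_trans _ _ (`|C| / (t / 2))).
    by rewrite ler_pM2r ?invr_gt0// ler_norm.
  by apply/ltW/(lt_le_trans (truncnS_gt _)); rewrite ler_nat.
exists N => m n /hN[m0 hm] /hN[n0 hn].
rewrite -(ltr_pXn2r (n := 2))// ?nnegrE ?rnorm_ge0 ?(ltW e0)//.
have := parallelogram (average m) (average n).
suff hmn : 2 * a <= rnorm (average m + average n).
  have := rnorm_ge0 (average m); have := rnorm_ge0 (average n).
  have := rnorm_ge0 (average m + average n).
  move: hm hn hmn te; move: (rnorm (average m)) (rnorm (average n)).
  move: (rnorm (_ + _)) (rnorm (_ - _)) => p q r s.
  move=> hm hn hmn te p0 s0 r0 h.
  have : 4 * a ^+ 2 <= p ^+ 2 by nra.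
  have : r ^+ 2 <= (a + t) ^+ 2 by nra.
  have : s ^+ 2 <= (a + t) ^+ 2 by nra.
  by nra.
(* With [n] copies of the first window and [m] copies of the second, the mean over [s] is the
   midpoint of the two averages, so [le_a] bounds its norm below by [a]. *)
pose s := flatten (nseq n (iota 0 m)) ++ flatten (nseq m (iota 0 n)).
have sumf j k : \sum_(i <- flatten (nseq j (iota 0 k))) v i = (\sum_(i < k) v i) *+ j.
  rewrite big_flatten /= big_nseq iter_addr_0; congr (_ *+ _).
  by rewrite -(big_mkord xpredT v) /index_iota subn0.
have szf j k : size (flatten (nseq j (iota 0 k))) = (j * k)%N.
  by rewrite size_flatten /shape map_nseq size_iota sumn_nseq mulnC.
have szs : size s = (2 * (n * m))%N by rewrite size_cat !szf (mulnC m) mul2n addnn.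
have s0 : s != [::] by rewrite -size_eq0 szs !muln_eq0 !negb_or -!lt0n n0 m0.
have := le_a _ s0.
rewrite szs big_cat /= !sumf.
have nmR : 0 < (n * m)%:R :> R by rewrite ltr0n muln_gt0 n0.
rewrite natrM mulrA (mulrC a) -ler_pdivlMr//.
rewrite (mulrC (rnorm _)) -rnorm_natV scalerDr => /le_trans; apply.
have natV p q (x : V) : (0 < p)%N -> (0 < q)%N ->
    ((p * q)%:R : R[i])^-1 *: (x *+ p) = (q%:R : R[i])^-1 *: x.
  move=> p0 q0; rewrite -(scaler_nat p x) scalerA natrM invfM; congr (_ *: _).
  by rewrite mulrAC mulVf ?mul1r// pnatr_eq0 -lt0n.
by rewrite natV// mulnC natV.
Qed.

End mean_ergodic.

(** * Measurable sections are closed under a.e. limits *)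

Section measurable_sections.
Context {d : measure_display} {T : measurableType d} {R : realType}.
Context {mu : {finite_measure set T -> \bar R}} (muC : measure_is_complete mu).
Context {H : measurable_bundle mu}.

(** Borel-Cantelli: the measures sum to at most [eps], so the limsup of the [B n] is null. *)
Lemma ae_eventually_notin (B : nat -> set T) (eps : R) : 0 <= eps ->
  (forall n, measurable (B n)) ->
  (forall n, (mu (B n) <= (eps / (2 ^ n.+1)%:R)%:E)%E) ->
  {ae mu, forall w, \forall n \near \oo, ~ B n w}.
Proof.
move=> eps0 mB Beps.
have mu0 : mu (lim_sup_set B) = 0%E.
  apply: lim_sup_set_cvg0 => //.
  apply: (@le_lt_trans _ _ (\sum_(n <oo) (eps / (2 ^ n.+1)%:R)%:E)%E).
    by apply: lee_nneseries => n *; [exact: measure_ge0|exact: Beps].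
  by apply: le_lt_trans (epsilon_trick0 _ eps0) _; rewrite ltry.
exists (lim_sup_set B); split=> //.
  by apply: bigcap_measurable => // n _; exact: bigcup_measurable.
move=> w /= h n _; apply: contrapT => hn; apply: h; exists n => // k /= nk Bk.
by apply: hn; exists k.
Qed.

Lemma steplike_mtotal (v : forall w, H w) : steplike v -> mtotal v.
Proof.
by move=> sv; exists (fun=> v); split=> //; apply: aeW => w; exact: cvg_cst.
Qed.

Lemma measurable_rnorm (v : forall w, H w) : mtotal v ->
  measurable_fun setT (fun w => rnorm (v w)).
Proof. by move=> /(cmeasurable_norm muC)[]. Qed.

Lemma mtotalB (v v' : forall w, H w) : mtotal v -> mtotal v' ->
  mtotal (fun w => v w - v' w).
Proof.
move=> mv mv'; have [v_ [sv cv]] := mtotalD mv (mtotalZ (cmeasurable_cst (- 1)) mv').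
by exists v_; split=> //; apply: filterS cv => w; rewrite scaleN1r.
Qed.

(** Egorov's theorem, applied to the distances from [v] to step-sections converging to it a.e. *)
Lemma steplike_approx (v : forall w, H w) (eps delta : R) :
  mtotal v -> 0 < eps -> 0 < delta -> exists s B,
  [/\ steplike s, measurable B, (mu B <= delta%:E)%E &
     forall w, ~ B w -> rnorm (v w - s w) < eps].
Proof.
move=> mv eps0 delta0; have [s [ss sv]] := mv.
have [||||||B [mB Bd unif]] := @ae_pointwise_almost_uniform _ _ _ mu
    (fun n w => rnorm (v w - s n w)) (fun=> 0) setT delta => //.
- by move=> n; apply: measurable_rnorm; apply: mtotalB => //; exact: steplike_mtotal.
- by rewrite ltey_eq fin_num_measure.
- apply: filterS sv => w /cvg_rnormP h _; apply/cvgrPdist_lt => e e0.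
  apply: filterS (h e e0) => n hn.
  by rewrite sub0r normrN ger0_norm// rnorm_ge0.
(* Functions below [eps] in absolute value off [B] form a neighbourhood of 0 for uniform convergence
   there, so some [s N] is close enough. *)
have : nbhs ((fun=> 0) : {uniform` setT `\` B -> R})
    [set h | forall w, (setT `\` B) w -> `|h w| < eps].
  apply/uniform_nbhs; exists [set p | ball p.1 eps p.2]; split.
    by rewrite -entourage_ballE; exists eps.
  by move=> h /= hB w /hB; rewrite /ball /= sub0r normrN.
move=> /unif[N _ /(_ N (leqnn N)) /= hN].
exists (s N), B; split=> //; first exact: ltW.
move=> w Bw; apply: le_lt_trans (hN w _) => //.
exact: ler_norm.
Qed.

(** Choose a step-section within [1 / (n + 1)] of [v_ n] off a set of measure at most
    [1 / 2 ^ (n + 1)]. By Borel-Cantelli almost every point avoids these sets eventually, and there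
    the step-sections converge to [v]. *)
Lemma mtotal_cvg (v_ : nat -> forall w, H w) (v : forall w, H w) :
  (forall n, mtotal (v_ n)) -> {ae mu, forall w, v_ n w @[n --> \oo] --> v w} ->
  mtotal v.
Proof.
move=> mv cv.
have /choice[s hs] : forall n, exists s, exists B,
    [/\ steplike s, measurable B, (mu B <= (1 / (2 ^ n.+1)%:R)%:E)%E &
     forall w, ~ B w -> rnorm (v_ n w - s w) < n.+1%:R^-1].
  by move=> n; apply: steplike_approx; rewrite ?invr_gt0 ?divr_gt0 ?ltr0n ?expn_gt0.
have {hs}/choice[B hB] := hs.
have mB n : measurable (B n) by have [] := hB n.
have Ble n : (mu (B n) <= (1 / (2 ^ n.+1)%:R)%:E)%E by have [] := hB n.
exists s; split; first by move=> n; have [] := hB n.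
apply: filterS2 cv (ae_eventually_notin ler01 mB Ble) => w cw Bw.
apply/cvg_rnormP => e e0; have e20 : 0 < e / 2 by rewrite divr_gt0.
move/cvg_rnormP : cw => /(_ _ e20) cw.
near=> n.
have -> : v w - s n w = (v w - v_ n w) + (v_ n w - s n w) by rewrite addrA subrK.
apply: le_lt_trans (ler_rnormD _ _) _; rewrite [ltRHS]splitr ltrD//.
  by near: n.
have [_ _ _ hn] := hB n.
apply: lt_trans (hn w _) _; first by near: n.
near: n; exact: (near_infty_natSinv_lt (PosNum e20)).
Unshelve. all: by end_near. Qed.

End measurable_sections.

(** * Order, norm, contractions and (bo)-convergence in pointwise terms *)

Section L0_order.
Context {d : measure_display} {T : measurableType d} {R : realType}.
Context {mu : {finite_measure set T -> \bar R}} (muC : measure_is_complete mu).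
Context {H : measurable_bundle mu}.
Implicit Types (a b c : L0 mu) (x y : L0sec H).

Lemma cmeasurable_real (g : T -> R) :
  measurable_fun setT g -> cmeasurable (fun w => (g w)%:C%C).
Proof. by move=> mg; split=> //; exact: measurable_cst. Qed.

Definition L0_real (g : T -> R) (mg : measurable_fun setT g) : L0 mu :=
  L0_class mu (CMFun (cmeasurable_real mg)).

Lemma L0_fun_real (g : T -> R) (mg : measurable_fun setT g) :
  {ae mu, forall w, L0_fun (L0_real mg) w = (g w)%:C%C}.
Proof.
have h := @L0_classK _ _ _ mu (CMFun (cmeasurable_real mg)).
by apply: filterS h => w; apply.
Qed.

Lemma L0_funD a b :
  {ae mu, forall w, L0_fun (a + b) w = L0_fun a w + L0_fun b w}.
Proof. by have h := L0_fun_add a b; apply: filterS h => w; apply. Qed.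

Lemma L0_lerD a b c (e : L0 mu) : a <= b -> c <= e -> a + c <= b + e.
Proof.
move=> /L0_leP ab /L0_leP ce; apply/L0_leP.
have h1 := L0_funD a c; have h2 := L0_funD b e.
near=> w; rewrite (near h1 w)// (near h2 w)//.
by rewrite lerD// ?(near ab w)// (near ce w).
Unshelve. all: by end_near. Qed.

Lemma L0_lerBlDr a b c : (a - c <= b) = (a <= b + c).
Proof.
apply/idP/idP => h.
  by have := L0_lerD h (lexx c); rewrite subrK.
by have := L0_lerD h (lexx (- c)); rewrite addrK.
Qed.

Lemma L0sec_fun0 : {ae mu, forall w, L0sec_fun (0 : L0sec H) w = 0}.
Proof. exact: L0sec_fun_zero. Qed.

Lemma L0sec_funD x y :
  {ae mu, forall w, L0sec_fun (x + y) w = L0sec_fun x w + L0sec_fun y w}.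
Proof. exact: L0sec_fun_add. Qed.

Lemma L0sec_funB x y :
  {ae mu, forall w, L0sec_fun (x - y) w = L0sec_fun x w - L0sec_fun y w}.
Proof.
have h1 := L0sec_funD x (- y); have h2 := L0sec_fun_opp y.
by near=> w; rewrite (near h1 w)// (near h2 w).
Unshelve. all: by end_near. Qed.

Lemma L0sec_fun_sum (I : Type) (r : seq I) (F : I -> L0sec H) :
  {ae mu, forall w, L0sec_fun (\sum_(i <- r) F i) w = \sum_(i <- r) L0sec_fun (F i) w}.
Proof.
elim: r => [|i r IH].
  rewrite big_nil; have h := L0sec_fun0.
  by apply: filterS h => w ->; rewrite big_nil.
rewrite big_cons; have h := L0sec_funD (F i) (\sum_(j <- r) F j).
by apply: filterS2 h IH => w -> ->; rewrite big_cons.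
Qed.

Lemma L0sec_fun_cstZ (z : R[i]) x :
  {ae mu, forall w, L0sec_fun (L0_cst mu z *: x) w = z *: L0sec_fun x w}.
Proof.
have h1 := L0sec_fun_scale (L0_cst mu z) x; have h2 := @L0_fun_cst _ _ _ mu z.
by near=> w; rewrite (near h1 w)// (near h2 w).
Unshelve. all: by end_near. Qed.

Lemma L0norm_leP x (e : L0 mu) : L0norm muC x <= e <->
  {ae mu, forall w, (rnorm (L0sec_fun x w))%:C%C <= L0_fun e w}.
Proof.
have h := L0_fun_norm muC x.
by split=> [/L0_leP|] xe; [|apply/L0_leP];
  apply: filterS2 h xe => w; rewrite rnormE => ->.
Qed.

Lemma L0norm_le x y : L0norm muC x <= L0norm muC y <->
  {ae mu, forall w, rnorm (L0sec_fun x w) <= rnorm (L0sec_fun y w)}.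
Proof.
split=> [/L0norm_leP|] xy; [|apply/L0norm_leP];
  by have h := L0_fun_norm muC y; apply: filterS2 h xy => w ->; rewrite rnormE lecR.
Qed.

Lemma L0norm_triangle x y : L0norm muC (x + y) <= L0norm muC x + L0norm muC y.
Proof.
apply/L0norm_leP; have h1 := L0_fun_norm muC x; have h2 := L0_fun_norm muC y.
have h3 := L0_funD (L0norm muC x) (L0norm muC y); have h4 := L0sec_funD x y.
near=> w; rewrite (near h3 w)// (near h1 w)// (near h2 w)// (near h4 w)//.
by rewrite -rnormE ler_normD.
Unshelve. all: by end_near. Qed.

Lemma L0norm_le1 x :
  L0norm muC x <= 1 <-> {ae mu, forall w, rnorm (L0sec_fun x w) <= 1}.
Proof.
have h := @L0_fun_cst _ _ _ mu 1.
by split=> [/L0norm_leP|] x1; [|apply/L0norm_leP];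
  apply: filterS2 h x1 => w -> //; rewrite -(rmorph1 (real_complex R)) lecR.
Qed.

(* Scaling [x] by [1 / (|x| + eps)] instead of [1 / |x|] avoids treating the
   zero set of [x] separately. *)
Lemma contraction_le (S : {linear L0sec H -> L0sec H}) x :
  L0_contraction muC S -> L0norm muC (S x) <= L0norm muC x.
Proof.
move=> [Sb S1]; apply/L0norm_le.
(* The tolerances [1 / (n + 1)] are countably many, so one null set serves them all. *)
suff le_eps n : {ae mu, forall w,
    rnorm (L0sec_fun (S x) w) <= rnorm (L0sec_fun x w) + n.+1%:R^-1}.
  have h := ae_foralln le_eps; apply: filterS h => w h.
  apply/ler_addgt0Pr => e e0.
  have [k _ /(_ _ (leqnn k)) ke] := near_infty_natSinv_lt (PosNum e0).
  by apply: (le_trans (h k)); rewrite lerD2l ltW.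
pose f w := rnorm (L0sec_fun x w) + n.+1%:R^-1.
have f0 w : 0 < f w by rewrite ltr_wpDl ?rnorm_ge0 ?invr_gt0.
have mf : measurable_fun setT f.
  by apply: measurable_funD => //; exact/(measurable_rnorm muC)/mtotal_fun.
have mfV : measurable_fun setT (fun w => (f w)^-1).
  apply: (eq_measurable_fun (fun w => f w `^ (-1))).
    by move=> w _; rewrite powR_inv1// ltW.
  exact: measurableT_comp (measurable_powR _) mf.
have fZ y : {ae mu, forall w,
    rnorm (L0sec_fun (L0_real mfV *: y) w) = (f w)^-1 * rnorm (L0sec_fun y w)}.
  have h1 := L0_fun_real mfV; have h2 := L0sec_fun_scale (L0_real mfV) y.
  near=> w; rewrite (near h2 w)// (near h1 w)// rnormZ// invr_ge0 ltW//.
have : L0norm muC (S (L0_real mfV *: x)) <= 1.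
  (* Boundedness of [S] makes [opnorm S] a true upper bound rather than a default value. *)
  apply: le_trans S1; have [ub _] := opnormP Sb; apply: ub.
  exists (L0_real mfV *: x) => //=.
  apply/L0norm_le1; have h := fZ x; apply: filterS h => w ->.
  by rewrite ler_pdivrMl// mulr1 lerDl invr_ge0.
rewrite linearZ => /L0norm_le1 le1; have h := fZ (S x).
by apply: filterS2 h le1 => w ->; rewrite ler_pdivrMl// mulr1.
Unshelve. all: by end_near. Qed.

Lemma contraction_iter_le (S : {linear L0sec H -> L0sec H}) n x :
  L0_contraction muC S -> L0norm muC (iter n S x) <= L0norm muC x.
Proof.
by move=> Sc; elim: n => //= n IH; exact: le_trans (contraction_le _ Sc) IH.
Qed.

(** The dominating sequence consists of the essential suprema [g n] of the tails of the distances,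
    measurable by construction. The pointwise suprema [h n] bound the tails, which yields existence
    of [g n], and [g n <= h n] a.e. makes the infimum 0. *)
Lemma ae_cvg_bo_cvg (x_ : nat -> L0sec H) x :
  {ae mu, forall w, L0sec_fun (x_ n) w @[n --> \oo] --> L0sec_fun x w} ->
  bo_cvg muC (fun m n : nat => (m <= n)%N) x_ x.
Proof.
move=> cv; pose f m w := rnorm (L0sec_fun (x - x_ m) w).
have mf m : measurable_fun setT (f m) by exact/(measurable_rnorm muC)/mtotal_fun.
have cf : {ae mu, forall w, forall e : R, 0 < e -> \forall m \near \oo, f m w < e}.
  have h := ae_foralln (fun m => L0sec_funB x (x_ m)).
  apply: filterS2 h cv => w hw /cvg_rnormP cw e e0.
  by apply: filterS (cw e e0) => m; rewrite /f hw.
pose A n w := [set f m w | m in [set m | (n <= m)%N]].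
pose h n w := sup (A n w).
have hA : {ae mu, forall w, forall n, has_ubound (A n w)}.
  apply: filterS cf => w cw n; have [N _ hN] := cw 1 ltr01.
  (* Terms before [N] are bounded by the sum, later ones by 1. *)
  exists (\sum_(i < N) f i w + 1) => _ [m _ <-].
  have [mN|Nm] := ltnP m N; last first.
    by rewrite (le_trans (ltW (hN m Nm)))// lerDr sumr_ge0// => i _; exact: rnorm_ge0.
  rewrite (bigD1 (Ordinal mN))//= -addrA lerDl addr_ge0// sumr_ge0// => i _.
  exact: rnorm_ge0.
have fh n m : (n <= m)%N -> {ae mu, forall w, f m w <= h n w}.
  move=> nm; apply: filterS hA => w /(_ n) ub.
  by apply: ub_le_sup => //; exists m.
have /choice[g hg] : forall n, exists g, [/\ measurable_fun setT g,
    forall m, (n <= m)%N -> {ae mu, forall w, f m w <= g w} &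
    forall k : T -> R, (forall m, (n <= m)%N -> {ae mu, forall w, f m w <= k w}) ->
      {ae mu, forall w, g w <= k w}].
  move=> n; have [||_ [m /= nm <-]|g [mg fg gf]] :=
      @ess_sup_family _ _ _ mu muC [set f m | m in [set m | (n <= m)%N]] (h n).
  - by exists (f n), n => //=.
  - by move=> _ [m _ <-].
  - exact: fh.
  exists g; split => // [m nm|k hk]; first by apply: fg; exists m.
  by apply: gf => _ [m nm <-]; exact: hk.
have mg n : measurable_fun setT (g n) by have [] := hg n.
have fg n m : (n <= m)%N -> {ae mu, forall w, f m w <= g n w}.
  by have [_ + _] := hg n; exact.
exists nat, (fun m n => (m <= n)%N), (fun n => L0_real (mg n)); split.
- split=> //; first by exists 0%N.
    by move=> i j k; exact: leq_trans.
  by move=> i j; exists (maxn i j); rewrite leq_maxl leq_maxr.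
- move=> n m nm; apply/L0_leP.
  have gle : {ae mu, forall w, g m w <= g n w}.
    by have [_ _ le] := hg m; apply: le => k mk; apply: fg; exact: leq_trans mk.
  have h1 := L0_fun_real (mg n); have h2 := L0_fun_real (mg m).
  by apply: filterS3 h1 h2 gle => w -> ->; rewrite lecR.
- split.
    move=> _ [n _ <-]; apply/L0_leP; have h0 := @L0_fun_cst _ _ _ mu 0.
    have h1 := L0_fun_real (mg n).
    apply: filterS3 h0 h1 (fg n n (leqnn n)) => w -> // -> hw.
    rewrite -(rmorph0 (real_complex R)) lecR; apply: le_trans hw; exact: rnorm_ge0.
  move=> c lbc; apply/L0_leP.
  have cg n : {ae mu, forall w, L0_fun c w <= (h n w)%:C%C}.
    have /L0_leP c1 : c <= L0_real (mg n) by apply: lbc; exists n.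
    have h1 := L0_fun_real (mg n).
    have gh : {ae mu, forall w, g n w <= h n w}.
      by have [_ _] := hg n; apply => m; exact: fh.
    apply: filterS3 c1 h1 gh => w cw gE gw.
    by rewrite gE in cw; apply: le_trans cw _; rewrite lecR.
  have h0 := @L0_fun_cst _ _ _ mu 0; have {}cg := ae_foralln cg.
  apply: filterS3 h0 cf cg => w -> // cw cgw.
  (* Comparability in [R[i]] includes equality of imaginary parts, so any one index shows that [c]
     is real; the real part needs large indices. *)
  have := cgw 0%N; rewrite !lecE /= => /andP[-> _] /=.
  apply/ler_addgt0Pr => e e0; rewrite add0r.
  have [N _ hN] := cw e e0; have := cgw N; rewrite lecE /= => /andP[_ cN].
  apply: le_trans cN _; apply: ge_sup; first by exists (f N w), N => /=.
  by move=> _ [m Nm <-]; exact/ltW/hN.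
move=> n; exists n => m nm; apply/L0norm_leP; have h1 := L0_fun_real (mg n).
by apply: filterS2 h1 (fg n m nm) => w ->; rewrite lecR.
Qed.

End L0_order.

(** * Averages of one operator, then induction on the number of operators *)

Section ergodic.
Context {d : measure_display} {T : measurableType d} {R : realType}.
Context {mu : {finite_measure set T -> \bar R}} (muC : measure_is_complete mu).
Context {H : measurable_bundle mu}.
Implicit Types (S : {linear L0sec H -> L0sec H}) (x y u : L0sec H).

Definition cesaro (S : L0sec H -> L0sec H) n x : L0sec H :=
  L0_cst mu n%:R^-1 *: \sum_(i < n) iter i S x.

Lemma iter_linear_sum S n (I : Type) (r : seq I) (F : I -> L0sec H) :
  iter n S (\sum_(i <- r) F i) = \sum_(i <- r) iter n S (F i).
Proof. by elim: n => //= n ->; rewrite linear_sum. Qed.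

Lemma iter_linearZ S n (a : L0 mu) x : iter n S (a *: x) = a *: iter n S x.
Proof. by elim: n => //= n ->; rewrite linearZ. Qed.

Lemma iter_linearB S n x y : iter n S (x - y) = iter n S x - iter n S y.
Proof. by elim: n => //= n ->; rewrite linearB. Qed.

Lemma cesaroB S n x y : cesaro S n (x - y) = cesaro S n x - cesaro S n y.
Proof.
rewrite /cesaro -scalerBr -sumrB; congr (_ *: _).
by apply: eq_bigr => i _; exact: iter_linearB.
Qed.

Lemma L0sec_fun_cesaro (S : L0sec H -> L0sec H) n x : {ae mu, forall w,
  L0sec_fun (cesaro S n x) w = n%:R^-1 *: \sum_(i < n) L0sec_fun (iter i S x) w}.
Proof.
have h1 := L0sec_fun_cstZ n%:R^-1 (\sum_(i < n) iter i S x).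
have h2 := L0sec_fun_sum (index_enum 'I_n) (fun i : 'I_n => iter i S x).
by apply: filterS2 h1 h2 => w -> ->.
Qed.

(** The bound is uniform in [n], so the averages of [y_ i] can be compared with those of [y] in
    [bo_cvg_cesaro]. *)
Lemma cesaro_le S n x : L0_contraction muC S ->
  L0norm muC (cesaro S n x) <= L0norm muC x.
Proof.
move=> Sc; apply/L0norm_le.
have h1 := L0sec_fun_cesaro S n x.
have h2 := ae_foralln (fun i => (L0norm_le muC _ _).1 (contraction_iter_le i x Sc)).
apply: filterS2 h1 h2 => w -> hw; rewrite rnorm_natV.
apply: (@le_trans _ _ (n%:R^-1 * (n%:R * rnorm (L0sec_fun x w)))).
  rewrite ler_wpM2l ?invr_ge0// (le_trans (ler_rnorm_sum _ _))//.
  apply: (@le_trans _ _ (\sum_(i < n) rnorm (L0sec_fun x w))).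
    by apply: ler_sum => i _; exact: hw.
  by rewrite sumr_const card_ord mulr_natl.
have [->|n0] := eqVneq n 0%N; first by rewrite mul0r mulr0 rnorm_ge0.
by rewrite mulrA mulVf ?mul1r// pnatr_eq0.
Qed.

(* Only the countably many inequalities between sums along the orbit of [u] are
   needed, so they hold simultaneously almost everywhere and no lifting of [S]
   to operators on the fibres is required. *)
Lemma orbit_shift_ae S u : L0_contraction muC S ->
  {ae mu, forall w, forall s : seq nat,
    rnorm (\sum_(i <- s) L0sec_fun (iter i.+1 S u) w) <=
    rnorm (\sum_(i <- s) L0sec_fun (iter i S u) w)}.
Proof.
move=> Sc; pose P (s : seq nat) w : Prop :=
  rnorm (\sum_(i <- s) L0sec_fun (iter i.+1 S u) w) <=
  rnorm (\sum_(i <- s) L0sec_fun (iter i S u) w).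
have aeP s : {ae mu, forall w, P s w}.
  have /L0norm_le le := contraction_le (\sum_(i <- s) iter i S u) Sc.
  rewrite linear_sum in le.
  have h1 := L0sec_fun_sum s (fun i => iter i.+1 S u).
  have h2 := L0sec_fun_sum s (fun i => iter i S u).
  by apply: filterS3 h1 h2 le => w h1w h2w; rewrite /P -h1w -h2w.
(* Enumerating the finite sequences by their codes reduces the claim to a countable intersection. *)
have aeP' n : {ae mu, forall w, forall s, unpickle n = Some s -> P s w}.
  case e: (unpickle n : option (seq nat)) => [s|]; last by apply: aeW.
  by have h := aeP s; apply: filterS h => w Pw _ [<-].
have h := ae_foralln aeP'; apply: filterS h => w hw s.
exact: hw (pickle s) s (pickleK s).
Qed.

(** The fibrewise theorem applies at almost every point by [orbit_shift_ae], and [mtotal_cvg] makes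
    the pointwise limit a measurable section. *)
Lemma mean_ergodic_L0 S u : L0_contraction muC S ->
  exists x, bo_cvg muC (fun m n : nat => (m <= n)%N) (fun n => cesaro S n u) x.
Proof.
move=> Sc; pose a n w : H w := L0sec_fun (cesaro S n u) w.
have ca : {ae mu, forall w, cvgn (a ^~ w)}.
  have h := ae_foralln (fun n => L0sec_fun_cesaro S n u).
  apply: filterS2 h (orbit_shift_ae u Sc) => w aw sw.
  rewrite (_ : a ^~ w = (fun n => n%:R^-1 *: \sum_(i < n) L0sec_fun (iter i S u) w)).
    exact: (mean_ergodic_cvg sw).
  by apply/funext => n; exact: aw.
have ml : mtotal (fun w => lim (a n w @[n --> \oo])).
  apply: (mtotal_cvg muC (v_ := a)) => //.
  by move=> n; exact: mtotal_fun.
exists (L0sec_class (total_msection ml)); apply: ae_cvg_bo_cvg.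
have h := L0sec_class_total ml.
by apply: filterS2 h ca => w ->.
Qed.

(** The condition on [p] says that it eventually passes every index, so the same dominating net
    works. *)
Lemma bo_cvg_reindex (I J : Type) (leI : I -> I -> Prop) (leJ : J -> J -> Prop)
    (p : J -> I) (x_ : I -> L0sec H) x :
  (forall i, exists j, forall k, leJ j k -> leI i (p k)) ->
  bo_cvg muC leI x_ x -> bo_cvg muC leJ (x_ \o p) x.
Proof.
move=> hp [G [leG [e [dG eG e0 ex]]]]; exists G, leG, e; split => // g.
by have [i hi] := ex g; have [j hj] := hp i; exists j => k /hj /hi.
Qed.

Lemma bo_cvg_cst (I : Type) (leI : I -> I -> Prop) x : (exists i : I, True) ->
  bo_cvg muC leI (fun=> x) x.
Proof.
move=> [i0 _]; exists unit, (fun _ _ => True), (fun=> 0); split => //.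
- by split=> [_ [_ _ <-]//|c lbc]; apply: lbc; exists tt.
- by move=> _; exists i0 => i _; rewrite subrr L0norm0.
Qed.

(** The inductive step. The limit is that of the averages of [y]. Sums of the nets dominating
    [y - y_ i] and [x - cesaro S m y], over the product index set, dominate the joint error. *)
Lemma bo_cvg_cesaro (I : Type) (leI : I -> I -> Prop) (y_ : I -> L0sec H) y S :
  L0_contraction muC S -> bo_cvg muC leI y_ y ->
  exists x, bo_cvg muC (fun p q : nat * I => (p.1 <= q.1)%N /\ leI p.2 q.2)
    (fun p => cesaro S p.1 (y_ p.2)) x.
Proof.
move=> Sc [G [leG [e [dG eG [e0 einf] ex]]]].
have [x [G' [leG' [e' [dG' eG' [e0' einf'] ex']]]]] := mean_ergodic_L0 y Sc.
exists x, (G * G')%type, (fun p q => leG p.1 q.1 /\ leG' p.2 q.2).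
exists (fun p => e p.1 + e' p.2); split.
- case: dG dG' => [[i _] rG tG uG] [[i' _] rG' tG' uG']; split.
  + by exists (i, i').
  + by move=> p; split.
  + by move=> p q r [pq pq'] [qr qr']; split; [exact: tG pq qr|exact: tG' pq' qr'].
  + move=> p q; have [r [pr qr]] := uG p.1 q.1; have [r' [pr' qr']] := uG' p.2 q.2.
    by exists (r, r').
- by move=> p q [/eG pq /eG' pq']; exact: L0_lerD.
- split.
    move=> _ [p _ <-]; rewrite -[0]addr0.
    by apply: L0_lerD; [apply: e0; exists p.1|apply: e0'; exists p.2].
  (* For fixed [g'], [c - e' g'] is a lower bound of [e], hence at most 0; so [c] is a lower bound
     of [e']. *)
  move=> c lbc; apply: einf' => _ [g' _ <-].
  rewrite -[e' g']add0r -L0_lerBlDr; apply: einf => _ [g _ <-].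
  by rewrite L0_lerBlDr; apply: lbc; exists (g, g').
move=> [g g'] /=; have [i hi] := ex g; have [n hn] := ex' g'.
exists (n, i) => -[m j] /= [/hn nm /hi ij].
have -> : x - cesaro S m (y_ j) = cesaro S m (y - y_ j) + (x - cesaro S m y).
  by rewrite cesaroB [RHS]addrC addrA subrK.
apply: le_trans (L0norm_triangle _ _ _) _; apply: L0_lerD => //.
exact: le_trans (cesaro_le _ _ Sc) ij.
Qed.

Lemma iter_nested_sum S k (ns : seq nat) (F : seq nat -> L0sec H) :
  iter k S (nested_sum ns F) = nested_sum ns (fun s => iter k S (F s)).
Proof.
elim: ns F => //= n ns IH F; rewrite iter_linear_sum.
by apply: eq_bigr => i _; exact: IH.
Qed.

Lemma eq_nested_sum (V : nmodType) (ns : seq nat) (F G : seq nat -> V) :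
  F =1 G -> nested_sum ns F = nested_sum ns G.
Proof.
by elim: ns F G => /= [|n ns IH] F G FG //; apply: eq_bigr => i _; exact: IH.
Qed.

Lemma L0_cstM (a b : R[i]) : L0_cst mu (a * b) = L0_cst mu a * L0_cst mu b.
Proof.
apply/L0_eqP.
have h1 := @L0_fun_cst _ _ _ mu (a * b); have h2 := @L0_fun_cst _ _ _ mu a.
have h3 := @L0_fun_cst _ _ _ mu b; have h4 := L0_fun_mul (L0_cst mu a) (L0_cst mu b).
by near=> w => _; rewrite (near h1 w)// (near h4 w)// (near h2 w)// (near h3 w).
Unshelve. all: by end_near. Qed.

(** The first operator is outermost in every composition, so by linearity its powers pull out of the
    scalar and of the inner sums. *)
Lemma ergodic_averageS k (S : 'I_k.+1 -> {linear L0sec H -> L0sec H})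
    (n : k.+1.-tuple nat) u :
  ergodic_average S n u = cesaro (S ord0) (thead n)
    (ergodic_average (fun j => S (lift ord0 j)) (behead_tuple n) u).
Proof.
case/tupleP: n => m n; rewrite theadE.
have -> : behead_tuple [tuple of m :: n] = n by apply/val_inj.
rewrite /ergodic_average /cesaro big_ord_recl tnth0 invfM L0_cstM -scalerA /=.
congr (_ *: _); rewrite scaler_sumr; apply: eq_bigr => i _.
rewrite iter_linearZ iter_nested_sum; congr (_ *: _).
  by congr (L0_cst mu _^-1); apply: eq_bigr => j _; rewrite tnthS.
by apply: eq_nested_sum => s; rewrite big_ord_recl.
Qed.

Lemma ergodic_average_cvg k (S : 'I_k -> {linear L0sec H -> L0sec H}) u :
  (forall j, L0_contraction muC (S j)) ->
  exists x, bo_cvg muC (@coordwise_le k) (fun n => ergodic_average S n u) x.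
Proof.
elim: k S => [|k IH] S Sc.
  (* With no operators the index set is a single point and the net is constant. *)
  exists (ergodic_average S [tuple] u).
  rewrite (_ : (fun n => _) = fun=> ergodic_average S [tuple] u).
    by apply: bo_cvg_cst; exists [tuple].
  by apply/funext => n; rewrite tuple0.
have [y hy] := IH (fun j => S (lift ord0 j)) (fun j => Sc _).
have [x hx] := bo_cvg_cesaro (Sc ord0) hy; exists x.
(* Splitting off the first coordinate turns the coordinatewise order into the product order of
   [bo_cvg_cesaro]. *)
pose p (n : k.+1.-tuple nat) := (thead n, behead_tuple n).
rewrite (_ : (fun n => _) = (fun q => cesaro (S ord0) q.1
    (ergodic_average (fun j => S (lift ord0 j)) q.2 u)) \o p); last first.
  by apply/funext => n; exact: ergodic_averageS.
apply: bo_cvg_reindex hx => -[m n]; exists [tuple of m :: n] => q.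
case/tupleP: q => m' n' le; split=> /=.
  by have := le ord0; rewrite !tnth0 theadE.
have -> : behead_tuple [tuple of m' :: n'] = n' by apply/val_inj.
by move=> j; have := le (lift ord0 j); rewrite !tnthS.
Qed.

End ergodic.

Theorem theorem3p4 (d0 : measure_display) (Omega : measurableType d0)
    (R : realType) (mu : {finite_measure set Omega -> \bar R})
    (muC : measure_is_complete mu) (H : measurable_bundle mu)
    (d : nat) (d_gt0 : (1 <= d)%N)
    (T : 'I_d -> {linear L0sec H -> L0sec H})
    (T_contraction : forall j, L0_contraction muC (T j)) (u : L0sec H) :
  exists x : L0sec H,
    bo_cvg muC (@coordwise_le d) (fun n => ergodic_average T n u) x.
Proof. exact: ergodic_average_cvg. Qed.
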